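(* For every $\varepsilon > 0$ there exists $0 < \delta < \varepsilon$ such that for all sufficiently large $n$ (depending on $\varepsilon$ and $\delta$) the following holds: if $A \subseteq \mathbb{R}$ has size $|A| = n$, then every set of at least $n^{\varepsilon}$ lines in $\mathbb{R}^2$, each of which intersects $A \times A$ in at least $n^{1-\delta}$ points, contains either two parallel lines or three lines with a common intersection point. *)

(* Defs.v *)
From HB Require Import structures.
From mathcomp Require Import all_boot all_order all_algebra.
From mathcomp Require Import all_classical all_reals all_analysis.

Set Implicit Arguments.
Unset Strict Implicit.
Unset Printing Implicit Defensive.

Import Order.TTheory GRing.Theory Num.Theory.
Local Open Scope classical_set_scope.
Local Open Scope ring_scope.

Definition line {R : realType} (a b c : R) : set (R * R) :=
  [set p | a * p.1 + b * p.2 = c].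

Definition is_line {R : realType} (L : set (R * R)) : Prop :=
  exists a b c : R, (a, b) <> (0, 0) /\ L = line a b c.

(* Same normal vector, hence same direction; a line is parallel to itself, so
   distinctness has to be required separately. *)
Definition parallel {R : realType} (L1 L2 : set (R * R)) : Prop :=
  exists a b c1 c2 : R,
    [/\ (a, b) <> (0, 0), L1 = line a b c1 & L2 = line a b c2].

(* The cardinality of [X], finite or infinite, is at least the real number
   [r]. *)
Definition card_at_least {R : realType} {T : Type} (r : R) (X : set T) : Prop :=
  exists2 m : nat, r <= m%:R & (`I_m #<= X)%card.

(* Main.v *)
(* A line which is neither vertical nor horizontal is the graph of an affine map,
   so that the lines become elements l_i of the group Aff(R); no two of them have
   the same slope and at most two send a given x to a given y.  A random walk on
   Aff(R) with steps l_i l_j^-1 moves points of A to points of A rather often, by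
   Cauchy-Schwarz; as an affine map is determined by two points, the probability
   of return to the identity is at least n^-3, also after boundedly many doublings
   of the length of the walk.  Hence at some bounded scale this probability drops
   only by a tiny power of n when the length is multiplied by four.  By the
   noncommutative Balog-Szemeredi-Gowers theorem the walk then gives large mass to
   a coset of a symmetric set S whose powers S^m, m bounded, have size at most n^4.
   The general position of the lines forces S to have n^(eps/2) slopes and a
   nontrivial commutator, which is a translation by some t.  Polynomials in the
   slopes, multiplied by t, are translations lying in powers of S; since a finite
   set X of real numbers has a quadratic polynomial image of size |X|^2, some
   power S^m has more than n^4 elements. *)
Require Import Defs.
From HB Require Import structures.
From mathcomp Require Import all_boot all_order all_algebra.
From mathcomp Require Import all_classical all_reals all_analysis.
From mathcomp Require Import fintype finset ring lra zify.

Set Implicit Arguments.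
Unset Strict Implicit.
Unset Printing Implicit Defensive.

Import Order.TTheory GRing.Theory Num.Theory.
Local Open Scope ring_scope.

(** * Finite sums, averages and counting *)

Lemma sum1_natr (F : realFieldType) (I : Type) (r : seq I) (P : pred I) :
  \sum_(i <- r | P i) 1 = (count P r)%:R :> F.
Proof. by rewrite big_const_seq iter_addr_0. Qed.

Lemma sum_natr_bool (F : realFieldType) (V : finType) (P : pred V) :
  \sum_(v : V) (P v)%:R = #|[set v | P v]|%:R :> F.
Proof.
rewrite -sum1_card natr_sum [RHS]big_mkcond /=.
by apply: eq_bigr => v _; rewrite inE; case: (P v).
Qed.

Lemma size_index_enum (V : finType) : size (index_enum V) = #|V|.
Proof. by rewrite cardT enumT [index_enum V]unlock. Qed.

Lemma sum_cst (F : realFieldType) (V : finType) (c : F) :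
  \sum_(v : V) c = #|V|%:R * c.
Proof. by rewrite big_const_seq iter_addr_0 count_predT size_index_enum mulr_natl. Qed.

Lemma cauchy_schwarz_sum (F : realFieldType) (I : Type) (r : seq I)
    (P : pred I) (a : I -> F) :
  (\sum_(i <- r | P i) a i) ^+ 2 <=
  (count P r)%:R * \sum_(i <- r | P i) a i ^+ 2.
Proof.
set A0 : F := _%:R; set A1 := \sum_(i <- r | P i) a i; set A2 := \sum_(i <- r | P i) _ ^+ 2.
have [c0|c0] := eqVneq (count P r) 0.
  rewrite /A1 big_hasC ?expr0n ?mulr_ge0 //; first by apply: sumr_ge0 => i _; exact: sqr_ge0.
  by rewrite has_count c0.
have A0gt : 0 < A0 by rewrite ltr0n lt0n.
have : 0 <= \sum_(i <- r | P i) (A0 * a i - A1) ^+ 2.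
  by apply: sumr_ge0 => i _; exact: sqr_ge0.
have -> : \sum_(i <- r | P i) (A0 * a i - A1) ^+ 2 = A0 * (A0 * A2 - A1 ^+ 2).
  transitivity (\sum_(i <- r | P i) (A0 ^+ 2 * a i ^+ 2 + (- (2 * A0 * A1) * a i + A1 ^+ 2 * 1))).
    by apply: eq_bigr => i _; ring.
  rewrite !big_split /= -!mulr_sumr sum1_natr -/A0 -/A1 -/A2; ring.
by rewrite pmulr_rge0 // subr_ge0.
Qed.

Lemma exists_ge_mean (F : realFieldType) (V : finType) (g : V -> F) (c : F) :
  (0 < #|V|)%N -> #|V|%:R * c <= \sum_v g v -> exists v, c <= g v.
Proof.
move=> V0 h; apply: contrapT => /forallNP H.
have : \sum_v g v < \sum_(v : V) c.
  apply: ltr_sum; last by move=> v _; rewrite ltNge; apply/negP/H.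
  by apply/hasP; have [v _] := card_gt0P V0; exists v; rewrite ?mem_index_enum.
by rewrite sum_cst ltNge h.
Qed.

Lemma sum_setX (F : realFieldType) (V : finType) (A B : {set V}) (h : V * V -> F) :
  \sum_(q in setX A B) h q = \sum_(a in A) \sum_(b in B) h (a, b).
Proof.
rewrite (pair_big (mem A) (mem B) (fun a b => h (a, b))) /=.
by apply: eq_big => [[a b]|[a b] _] //; rewrite inE.
Qed.

Lemma sum_eq_seq (F : realFieldType) (T : eqType) (s : seq T) (a : T) : uniq s ->
  \sum_(g <- s) (a == g)%:R = (a \in s)%:R :> F.
Proof.
move=> us; rewrite -count_uniq_mem // -sum1_count natr_sum big_mkcond [RHS]big_mkcond /=.
by apply: eq_bigr => g _; rewrite eq_sym; case: eqP.
Qed.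

(** Each fibre of [f] has at most [m] points, so [B] meets at least [#|B| / m] of them. *)
Lemma card_le_image (F : realFieldType) (T : eqType) (V : finType) (f : V -> T)
    (B : {set V}) (m : F) :
  (forall g, #|[set v | f v == g]|%:R <= m) ->
  #|B|%:R <= m * (size (undup [seq f v | v <- enum B]))%:R.
Proof.
move=> hm; set s := undup _.
have -> : #|B|%:R = \sum_(g <- s) \sum_(v in B) (f v == g)%:R :> F.
  rewrite exchange_big /= -sum1_card natr_sum; apply: eq_bigr => v vB.
  by rewrite sum_eq_seq ?undup_uniq // mem_undup map_f // mem_enum.
rewrite mulr_natr -(count_predT s) -iter_addr_0 -big_const_seq.
apply: ler_sum => g _; apply: le_trans (hm g).
rewrite -sum_natr_bool [leLHS]big_mkcond; apply: ler_sum => v _.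
by case: ifP.
Qed.

(** * Dependent random choice in dense graphs *)

Section Graph.
Variables (F : realFieldType) (V : finType) (e : rel V).
Let n : F := #|V|%:R.
Let codeg x z := #|[set y | e x y && e z y]|.

Lemma sum_codeg (P : rel V) :
  \sum_y \sum_x \sum_z (P x z && (e x y && e z y))%:R =
  \sum_x \sum_z (P x z)%:R * (codeg x z)%:R :> F.
Proof.
rewrite exchange_big; apply: eq_bigr => x _; rewrite exchange_big; apply: eq_bigr => z _.
rewrite -sum_natr_bool mulr_sumr; apply: eq_bigr => y _.
by rewrite -natrM mulnb.
Qed.

(* Dependent random choice: a random neighbourhood N(y) is large, while it
   contains few of the pairs having few common neighbours; then discard the
   vertices of N(y) which lie in many such pairs. *)
Lemma dependent_random_choice (alpha : F) :
  (0 < #|V|)%N -> 0 < alpha -> alpha * n ^+ 2 <= \sum_y \sum_x (e x y)%:R ->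
  exists U : {set V}, alpha / 4 * n <= #|U|%:R /\
    forall x x', x \in U -> x' \in U ->
      exists W : {set V}, alpha / 4 * n <= #|W|%:R /\
        forall z, z \in W -> alpha ^+ 2 / 32 * n <= (codeg x z)%:R /\
                             alpha ^+ 2 / 32 * n <= (codeg x' z)%:R.
Proof.
move=> V0 a0 dens.
have n0 : 0 < n by rewrite ltr0n.
pose b := alpha ^+ 2 / 32 * n.
pose bad x z := (codeg x z)%:R < b.
pose N y := [set x | e x y].
pose B y : F := \sum_x \sum_z (bad x z && (e x y && e z y))%:R.
have NE y : \sum_x (e x y)%:R = #|N y|%:R :> F.
  by rewrite sum_natr_bool.
(* The weight 16 is matched to the 32 in [b]: the bad pairs cost at most [16 * b * n ^+ 2], half of
   the lower bound [alpha ^+ 2 * n ^+ 3] that Cauchy-Schwarz gives for the squared degrees. *)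
have [y hy] : exists y, alpha ^+ 2 / 2 * n ^+ 2 <= #|N y|%:R ^+ 2 - 16 * B y.
  apply: exists_ge_mean => //; rewrite -/n.
  rewrite sumrB -mulr_sumr.
  have h1 : (alpha * n ^+ 2) ^+ 2 <= n * \sum_y #|N y|%:R ^+ 2.
    apply: le_trans (_ : (\sum_y #|N y|%:R) ^+ 2 <= _).
      rewrite ler_sqr ?nnegrE ?mulr_ge0 ?sqr_ge0 ?(ltW a0) ?sumr_ge0 //.
      by under [leRHS]eq_bigr do rewrite -NE.
    have := cauchy_schwarz_sum (index_enum V) predT (fun y => #|N y|%:R : F).
    by rewrite count_predT size_index_enum.
  have h2 : \sum_y B y <= b * n ^+ 2.
    rewrite /B sum_codeg.
    apply: le_trans (_ : \sum_(x : V) \sum_(z : V) b <= _).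
      apply: ler_sum => x _; apply: ler_sum => z _.
      rewrite /bad; case: ltP => [/ltW|_]; rewrite ?mul1r ?mul0r //.
      by rewrite /b mulr_ge0 ?divr_ge0 ?sqr_ge0 ?ler0n ?ltW.
    by rewrite !sum_cst -/n mulrA mulrC expr2.
  have h3 : alpha ^+ 2 * n ^+ 3 <= \sum_y #|N y|%:R ^+ 2.
    rewrite -(ler_pM2l n0); apply: le_trans h1.
    rewrite le_eqVlt; apply/orP; left; apply/eqP; ring.
  rewrite /b in h2; lra.
set A := N y in hy; pose a : F := #|A|%:R.
have a_ge0 : 0 <= a by exact: ler0n.
have B0 : 0 <= B y by rewrite !sumr_ge0 // => x _; rewrite sumr_ge0.
have an : 0 < alpha * n by exact: mulr_gt0.
have a_ge : alpha / 2 * n <= a.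
  by rewrite -/a in hy; rewrite leNgt; apply/negP => h; nra.
have aB : B y <= a ^+ 2 / 16.
  rewrite -/a in hy; have : 0 <= alpha ^+ 2 / 2 * n ^+ 2 by rewrite mulr_ge0 ?divr_ge0 ?sqr_ge0.
  lra.
(* The vertices outside [U] lie in more than [a / 4] bad pairs each, so by [aB] there are at most
   [a / 4] of them. Two vertices of [U] together spoil at most half of [A]; the rest of [A] serves
   as [W]. *)
pose badA x := [set z in A | bad x z].
pose U := [set x in A | #|badA x|%:R <= a / 4].
have hD : #|A :\: U|%:R * (a / 4) <= B y.
  rewrite -sum1_card natr_sum mulr_suml big_mkcond /=.
  apply: ler_sum => x _; rewrite !inE; case: ifP => [/andP[xU xA]|_]; last by rewrite sumr_ge0.
  rewrite xA /= -ltNge in xU; rewrite mul1r; apply: le_trans (ltW xU) _.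
  rewrite -sum1_card natr_sum big_mkcond /=.
  by apply: ler_sum => z _; rewrite !inE xA /= andbC; case: (_ && _).
have hU : a / 4 * 3 <= #|U|%:R.
  have -> : #|U|%:R = a - #|A :\: U|%:R.
    have sUA : U \subset A by apply/subsetP => x; rewrite inE => /andP[].
    by rewrite cardsD (setIidPr sUA) natrB ?subset_leq_card // opprB addrCA subrr addr0.
  have ap : 0 < a by lra.
  have : #|A :\: U|%:R * (a / 4) <= a / 4 * (a / 4) by lra.
  by rewrite ler_pM2r; lra.
exists U; split=> [|x x' xU x'U]; first by lra.
exists (A :\: (badA x :|: badA x')); split.
  have h : #|badA x :|: badA x'|%:R <= a / 2.
    apply: le_trans (_ : (#|badA x| + #|badA x'|)%:R <= _); first by rewrite ler_nat leq_card_setU.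
    by move: xU x'U; rewrite !inE natrD => /andP[_ ?] /andP[_ ?]; lra.
  apply: le_trans (_ : a - #|badA x :|: badA x'|%:R <= _); first by lra.
  rewrite lerBlDr -natrD ler_nat addnC -(cardsID (badA x :|: badA x') A).
  by rewrite leq_add2r subset_leq_card ?subsetIr.
move=> z /setDP[]; rewrite {1}inE => zA; rewrite !inE zA negb_or /= => /andP[hx hz].
by rewrite !leNgt hx hz.
Qed.
End Graph.

(** * The noncommutative Balog-Szemeredi-Gowers theorem *)

Section ApproximateGroup.
Variables (F : realFieldType) (G : groupType).

Definition subprob (w : G -> F) :=
  (forall g, 0 <= w g) /\ forall Z, uniq Z -> \sum_(g <- Z) w g <= 1.

(* [popular c X] bounds the cardinality of [X] by [1 / c], in a form which is
   stable under taking products. *)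
Definition popular (c : F) (X : G -> Prop) :=
  exists w, subprob w /\ forall g, X g -> c <= w g.

Lemma popular_size c X Z : popular c X -> uniq Z -> (forall g, g \in Z -> X g) ->
  (size Z)%:R * c <= 1.
Proof.
move=> [w [[w0 w1] wX]] uZ ZX; apply: le_trans (w1 Z uZ).
rewrite mulr_natl -(count_predT Z) -iter_addr_0 -big_const_seq.
by rewrite big_seq [leRHS]big_seq; apply: ler_sum => g /ZX/wX.
Qed.

Lemma ler_sum_subseq (s s' : seq G) (w : G -> F) : (forall g, 0 <= w g) ->
  uniq s -> uniq s' -> {subset s <= s'} -> \sum_(g <- s) w g <= \sum_(g <- s') w g.
Proof.
move=> w0 us us' ss'; have hp : perm_eq s [seq g <- s' | g \in s].
  apply: uniq_perm => //; first exact: filter_uniq.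
  by move=> g; rewrite mem_filter; case: (boolP (g \in s)) => // /ss'.
by rewrite (perm_big _ hp) big_filter big_mkcond; apply: ler_sum => g _; case: ifP.
Qed.

(** The witness is the convolution of the two weights, cut down to the finite list [H]: each of the
    [t] factorizations of [z] contributes at least [c1 * c2]. *)
Lemma popular_conv (H : seq G) c1 c2 t X Y Z : 0 <= c1 -> 0 <= c2 ->
  popular c1 X -> popular c2 Y ->
  (forall z, Z z -> exists H', [/\ uniq H', {subset H' <= H}, t <= (size H')%:R &
      forall h, h \in H' -> X h /\ Y (h^-1 * z)%g]) ->
  popular (t * (c1 * c2)) Z.
Proof.
move=> c10 c20 [w1 [[w10 w11] wX]] [w2 [[w20 w21] wY]] hZ.
exists (fun z => \sum_(h <- undup H) w1 h * w2 (h^-1 * z)%g); split; [split|].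
- by move=> g; apply: sumr_ge0 => h _; rewrite mulr_ge0.
- move=> Q uQ; rewrite exchange_big /=; apply: le_trans (w11 _ (undup_uniq H)).
  apply: ler_sum => h _; rewrite -mulr_sumr ler_piMr //.
  rewrite -(big_map (fun z => h^-1 * z)%g predT w2); apply: w21.
  by rewrite map_inj_uniq //; exact: mulgI.
- move=> z /hZ[H' [uH' H'H tH' hH']].
  apply: (@le_trans _ _ (\sum_(h <- H') w1 h * w2 (h^-1 * z)%g)); last first.
    apply: (ler_sum_subseq (w := fun h => w1 h * w2 (h^-1 * z)%g)) => //.
    - by move=> h; rewrite mulr_ge0.
    - exact: undup_uniq.
    - by move=> h /H'H; rewrite mem_undup.
  apply: le_trans (ler_wpM2r (mulr_ge0 c10 c20) tH') _.
  rewrite mulr_natl -(count_predT H') -iter_addr_0 -big_const_seq.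
  rewrite big_seq [leRHS]big_seq; apply: ler_sum => h /hH'[/wX ? /wY ?].
  exact: ler_pM.
Qed.

Section Law.
Variables (V : finType) (f : V -> G).

Definition law g : F := #|[set v | f v == g]|%:R / #|V|%:R.

Lemma law_subprob : subprob law.
Proof.
split=> [g|Z uZ]; first by rewrite divr_ge0.
have [V0|V0] := posnP #|V|.
  by rewrite big1 // => g _; rewrite /law V0 invr0 mulr0.
rewrite -mulr_suml ler_pdivrMr ?ltr0n // mul1r.
under eq_bigr do rewrite -sum_natr_bool.
rewrite exchange_big /= -[leRHS]mulr1 -sum_cst; apply: ler_sum => v _.
by rewrite sum_eq_seq // lern1 leq_b1.
Qed.

(** Cauchy-Schwarz for the fibre sizes [N g]: they add up to [#|B|], and their squares add up to the
    number of collisions. *)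
Lemma collision_lower_bound (B : {set V}) :
  #|B|%:R ^+ 2 <= (size (undup [seq f v | v <- enum B]))%:R *
    \sum_(v in B) \sum_(w in B) (f v == f w)%:R :> F.
Proof.
set s := undup _.
pose N g : F := \sum_(v in B) (f v == g)%:R.
have fs v : v \in B -> f v \in s by move=> vB; rewrite mem_undup map_f // mem_enum.
have -> : #|B|%:R = \sum_(g <- s) N g.
  rewrite exchange_big /= -sum1_card natr_sum; apply: eq_bigr => v /fs vs.
  by rewrite sum_eq_seq ?undup_uniq // vs.
have -> : \sum_(v in B) \sum_(w in B) (f v == f w)%:R = \sum_(g <- s) N g ^+ 2.
  under [RHS]eq_bigr do rewrite expr2 mulr_suml.
  rewrite [RHS]exchange_big /=; apply: eq_bigr => v vB.
  under [RHS]eq_bigr do rewrite mulr_sumr.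
  rewrite [RHS]exchange_big /=; apply: eq_bigr => w wB.
  under [RHS]eq_bigr do rewrite -natrM mulnb.
  case: eqP => [->|vw].
    by under eq_bigr do rewrite andbb; rewrite sum_eq_seq ?undup_uniq // fs.
  rewrite big1 // => g _; case: eqP => // <-; case: eqP => // wv.
  by case: vw.
by have := cauchy_schwarz_sum s predT N; rewrite count_predT.
Qed.
End Law.
End ApproximateGroup.

(** The length is exactly [m], not at most [m]: [S] need not contain 1, so shorter products have to
    be padded by factors [s * s^-1]. *)
Fixpoint word (G : groupType) (S : seq G) m (z : G) : Prop :=
  if m is m'.+1 then exists s z', [/\ s \in S, word S m' z' & z = (s * z')%g]
  else z = 1%g.

Section BalogSzemerediGowers.
Variables (F : realFieldType) (G : groupType) (V : finType) (f : V -> G).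
Variables (p : F).
Let n : F := #|V|%:R.
Hypotheses (V0 : (0 < #|V|)%N) (p0 : 0 < p).
Hypothesis fp : forall g, #|[set v | f v == g]|%:R <= p * n.

Let n0 : 0 < n. Proof. by rewrite ltr0n. Qed.

Definition quotients (U : {set V}) (g : G) :=
  exists x x', [/\ x \in U, x' \in U & g = (f x / f x')%g].

Let kappa := law F (fun q : V * V => (f q.1 / f q.2)%g).

(** For fixed [y] the value [f x] has to be [g * f y], and [fp] bounds the number of such [x]. *)
Lemma quotient_law_le g : kappa g <= p.
Proof.
rewrite /kappa /law card_prod natrM -/n ler_pdivrMr ?mulr_gt0 // -sum_natr_bool.
rewrite -(pair_big predT predT (fun x y => ((f x / f y)%g == g)%:R : F)) /= exchange_big /=.
apply: le_trans (_ : \sum_(y : V) p * n <= _); last by rewrite sum_cst -/n mulrCA.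
apply: ler_sum => y _; rewrite sum_natr_bool; apply: le_trans (fp (g * f y)%g).
by rewrite ler_nat subset_leq_card //; apply/subsetP => x; rewrite !inE => /eqP <-; rewrite mulgVK.
Qed.

Lemma card_le_values (B : {set V}) (c : F) : c * n <= #|B|%:R ->
  c / p <= (size (undup [seq f v | v <- enum B]))%:R.
Proof.
move=> cB; have := le_trans cB (card_le_image B fp).
by rewrite mulrAC ler_pM2r // ler_pdivrMr // mulrC.
Qed.

(** Join [x] and [y] when [f x / f y] has mass at least [p / (2 * K)]. Dependent random choice
    yields [U] such that any two of its points are linked by many paths of length 4, so that each
    quotient over [U] is in many ways a product of four popular quotients. Two convolutions turn
    this into a weight. *)
Lemma exists_popular_quotients (K : F) : 1 <= K ->
  p / K * n ^+ 2 <= \sum_x \sum_y kappa (f x / f y)%g ->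
  exists U : {set V}, n / (8 * K) <= #|U|%:R /\
    popular (p / (2 ^+ 21 * K ^+ 9)) (quotients U).
Proof.
move=> K1 energy; have K0 : 0 < K by lra.
have Kn0 : K != 0 by rewrite gt_eqF.
have pn0 : p != 0 by rewrite gt_eqF.
pose P g := p / (2 * K) <= kappa g.
pose e x y := P (f x / f y)%g.
have pK0 : 0 <= p / (2 * K) by rewrite divr_ge0 ?mulr_ge0 ?ltW.
have popP : popular (p / (2 * K)) P.
  by exists kappa; split => //; exact: law_subprob.
(* Non-edges contribute at most half of the energy, and an edge contributes at most [p]. *)
have dens : (2 * K)^-1 * n ^+ 2 <= \sum_y \sum_x (e x y)%:R.
  rewrite exchange_big /=.
  have : \sum_x \sum_y kappa (f x / f y)%g <=
         \sum_(x : V) \sum_(y : V) (p / (2 * K) + p * (e x y)%:R).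
    apply: ler_sum => x _; apply: ler_sum => y _.
    rewrite /e /P; case: (leP (p / (2 * K)) (kappa _)) => [_|/ltW h]; last by rewrite mulr0n mulr0 addr0.
    by rewrite mulr1n mulr1; apply: le_trans (quotient_law_le _) _; rewrite lerDr.
  have -> : \sum_(x : V) \sum_(y : V) (p / (2 * K) + p * (e x y)%:R) =
      n * (n * (p / (2 * K))) + p * \sum_x \sum_y (e x y)%:R.
    rewrite mulr_sumr -sum_cst -big_split; apply: eq_bigr => x _.
    by rewrite big_split sum_cst mulr_sumr.
  move=> /(le_trans energy) h.
  rewrite -(ler_pM2l p0); set T := \sum_x _ in h *.
  have -> : p * ((2 * K)^-1 * n ^+ 2) = p / K * n ^+ 2 - n * (n * (p / (2 * K))) by field.
  lra.
have a0 : 0 < (2 * K)^-1 by rewrite invr_gt0 mulr_gt0.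
have [U [Uge hU]] := dependent_random_choice V0 a0 dens.
exists U; split; first by apply: le_trans Uge; rewrite le_eqVlt; apply/orP; left; apply/eqP; field.
pose c0 : F := (128 * K ^+ 2)^-1.
have c0E : (2 * K)^-1 ^+ 2 / 32 = c0 by rewrite /c0; field.
(* Quotients along pairs with many common neighbours, that is, products of two popular quotients in
   many ways. The middle vertices give at least [c0 / p] distinct group elements, since each value
   of [f] is taken at most [p * n] times. *)
pose Q g := exists x z, g = (f x / f z)%g /\ c0 * n <= #|[set y | e x y && e z y]|%:R.
pose H := [seq (f q.1 / f q.2)%g | q : V * V].
have eC x y : e x y = e y x.
  rewrite /e /P /kappa /law; congr (_ <= _%:R / _).
  have swapI : injective (fun q : V * V => (q.2, q.1)) by move=> [? ?] [? ?] [-> ->].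
  rewrite -(card_imset _ swapI); congr #|pred_of_set _|.
  apply/setP => -[u v]; rewrite inE /=; apply/imsetP/idP => [[[u' v']]|].
    by rewrite inE /= => /eqP h [-> ->]; rewrite -invgF h invgF.
  by move=> /eqP h; exists (v, u) => //; rewrite inE /= -invgF h invgF.
have popQ : popular (c0 / p * (p / (2 * K) * (p / (2 * K)))) Q.
  apply: (popular_conv (H := H) pK0 pK0 popP popP).
  move=> g [x [z [-> hxz]]]; have hs := card_le_values hxz.
  set s := undup _ in hs.
  exists [seq (f x / h)%g | h <- s]; split.
  - rewrite map_inj_uniq ?undup_uniq // => h h' /mulgI; exact: invg_inj.
  - move=> _ /mapP[h + ->]; rewrite mem_undup => /mapP[y _ ->].
    by apply/codomP; exists (x, y).
  - by rewrite size_map.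
  - move=> _ /mapP[h + ->]; rewrite mem_undup => /mapP[y + ->].
    rewrite mem_enum inE => /andP[exy ezy]; split => //.
    by rewrite invgF mulgA mulgVK -/(e y z) eC.
have cQ0 : 0 <= c0 / p * (p / (2 * K) * (p / (2 * K))).
  by rewrite !mulr_ge0 ?invr_ge0 ?mulr_ge0 ?exprn_ge0 ?(ltW K0) ?(ltW p0).
have -> : p / (2 ^+ 21 * K ^+ 9) = ((8 * K)^-1 / p) *
   ((c0 / p * (p / (2 * K) * (p / (2 * K)))) * (c0 / p * (p / (2 * K) * (p / (2 * K))))).
  by rewrite /c0; field; rewrite pn0 Kn0.
apply: (popular_conv (H := H) cQ0 cQ0 popQ popQ).
move=> g [x [x' [xU x'U ->]]]; have [W [Wge hW]] := hU _ _ xU x'U.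
have hs : (8 * K)^-1 / p <= (size (undup [seq f v | v <- enum W]))%:R.
  by apply: card_le_values; apply: le_trans Wge; rewrite le_eqVlt; apply/orP; left; apply/eqP; field.
set s := undup _ in hs.
exists [seq (f x / h)%g | h <- s]; split.
- rewrite map_inj_uniq ?undup_uniq // => h h' /mulgI; exact: invg_inj.
- move=> _ /mapP[h + ->]; rewrite mem_undup => /mapP[y _ ->].
  by apply/codomP; exists (x, y).
- by rewrite size_map.
- move=> _ /mapP[h + ->]; rewrite mem_undup => /mapP[z + ->].
  rewrite mem_enum => /hW; rewrite c0E => -[h1 h2]; split; first by exists x, z.
  exists z, x'; split; first by rewrite invgF mulgA mulgVK.
  by apply: le_trans h2 _; rewrite ler_nat subset_leq_card //; apply/subsetP => y; rewrite !inE andbC.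
Qed.

(* [S] consists of the elements with many representations [(f c)^-1 * f d],
   c, d in U.  Inserting such representations in [f x * (s_1 ... s_m) / f y] and
   regrouping writes it in many ways as a product of m + 1 elements of the small
   set [quotients U]. *)
Lemma approximate_group (K : F) : 1 <= K ->
  p / K * n ^+ 2 <= \sum_x \sum_y kappa (f x / f y)%g ->
  exists S : seq G,
  [/\ forall s, s \in S -> s^-1%g \in S,
      exists a, n / (2 ^+ 31 * K ^+ 12) <= #|[set v | (a^-1 * f v)%g \in S]|%:R &
      forall m Z, uniq Z -> (forall z, z \in Z -> word S m z) ->
        (size Z)%:R * (p / (2 ^+ 49 * K ^+ 20) ^+ m.+1) <= 1].
Proof.
move=> K1 /(exists_popular_quotients K1) [U [Uge popD]].
have K0 : 0 < K by lra.
have Kn0 : K != 0 by rewrite gt_eqF.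
have pn0 : p != 0 by rewrite gt_eqF.
have nn0 : n != 0 by rewrite gt_eqF.
pose d : F := (2 ^+ 21 * K ^+ 9)^-1.
have d0 : 0 < d by rewrite invr_gt0 mulr_gt0 ?exprn_gt0.
rewrite -/d in popD.
pose u : F := #|U|%:R.
have nK0 : 0 <= n / (8 * K) by rewrite divr_ge0 ?mulr_ge0 ?ltW.
have u0 : 0 < u by apply: lt_le_trans Uge; rewrite divr_gt0 ?mulr_gt0.
pose A := setX U U.
pose phi (q : V * V) := (f q.1 / f q.2)%g.
have sizeD : (size (undup [seq phi q | q <- enum A]))%:R * (p * d) <= 1.
  apply: popular_size popD (undup_uniq _) _ => g.
  rewrite mem_undup => /mapP[[x x']]; rewrite mem_enum inE /= => /andP[xU x'U] ->.
  by exists x, x'.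
(* The equation says [(f c)^-1 * f x = (f a)^-1 * f b], so [qn a b] counts the representations of
   the latter. In the form chosen, the sum over [a] and [b] counts the collisions of [phi] on [U] x
   [U], of which there are many because [phi] has few values there. *)
pose qn a b : F := \sum_(c in U) \sum_(x in U) ((f c / f a)%g == (f x / f b)%g)%:R.
have qn0 a b : 0 <= qn a b by rewrite sumr_ge0 // => c _; rewrite sumr_ge0.
have energyU : u ^+ 4 * (p * d) <= \sum_(a in U) \sum_(b in U) qn a b.
  have -> : \sum_(a in U) \sum_(b in U) qn a b =
            \sum_(q in A) \sum_(q' in A) (phi q == phi q')%:R.
    rewrite sum_setX [RHS]exchange_big /=; apply: eq_bigr => a _.
    rewrite /qn exchange_big /=; apply: eq_bigr => c _.
    by rewrite sum_setX exchange_big.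
  have := @collision_lower_bound F _ _ phi A; rewrite cardsX natrM -/u.
  set E := \sum_(q in A) _ => h.
  have E0 : 0 <= E by rewrite sumr_ge0 // => q _; rewrite sumr_ge0.
  have pd0 : 0 < p * d by rewrite mulr_gt0.
  have -> : u ^+ 4 * (p * d) = (u * u) ^+ 2 * (p * d) by ring.
  apply: le_trans (ler_wpM2r (ltW pd0) h) _.
  by rewrite mulrAC ler_piMl.
(* Half of the mean of [qn] over pairs in [U] that [energyU] guarantees. *)
pose tau := u ^+ 2 * (p * d) / 2.
pose good a b := [&& a \in U, b \in U & tau <= qn a b].
have tau0 : 0 <= tau by rewrite divr_ge0 ?mulr_ge0 ?exprn_ge0 ?ltW.
have goodC a b : good a b = good b a.
  rewrite /good andbCA; congr [&& _, _ & _ <= _].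
  by rewrite /qn exchange_big; apply: eq_bigr => c _; apply: eq_bigr => x _; rewrite eq_sym.
have col a b c : \sum_(x in U) ((f c / f a)%g == (f x / f b)%g)%:R <= p * n.
  apply: le_trans (fp (f c / f a * f b)%g); rewrite -sum_natr_bool big_mkcond.
  apply: ler_sum => x _; case: ifP => // _; case: eqP => // ->.
  by rewrite mulgVK eqxx.
have many : u ^+ 3 * d / 2 <= n * \sum_a \sum_b (good a b)%:R.
  have : \sum_(a in U) \sum_(b in U) qn a b <=
         \sum_(a in U) \sum_(b in U) (tau + u * (p * n) * (good a b)%:R).
    apply: ler_sum => a aU; apply: ler_sum => b bU.
    rewrite /good aU bU /=; case: (leP tau (qn a b)) => [_|/ltW h]; last by rewrite mulr0n mulr0 addr0.
    rewrite mulr1n mulr1; apply: le_trans (_ : u * (p * n) <= _); last by rewrite lerDr.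
    rewrite /u -sum1_card natr_sum mulr_suml; apply: ler_sum => c _.
    by rewrite mul1r.
  have -> : \sum_(a in U) \sum_(b in U) (tau + u * (p * n) * (good a b)%:R) =
     u ^+ 2 * tau + u * (p * n) * \sum_a \sum_b (good a b)%:R.
    have -> : \sum_a \sum_b (good a b)%:R = \sum_(a in U) \sum_(b in U) (good a b)%:R :> F.
      rewrite [RHS]big_mkcond; apply: eq_bigr => a _; rewrite /good.
      case: (a \in U); last by rewrite big1.
      by rewrite [RHS]big_mkcond; apply: eq_bigr => b _; case: (b \in U).
    have -> : u ^+ 2 * tau = \sum_(a in U) \sum_(b in U) tau.
      by rewrite !sumr_const -mulrnA -mulr_natl natrM -/u expr2.
    rewrite mulr_sumr -big_split; apply: eq_bigr => a _.
    by rewrite mulr_sumr -big_split.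
  move=> /(le_trans energyU); set Gm := \sum_a _ => h.
  rewrite -(ler_pM2l (mulr_gt0 u0 p0)).
  have -> : u * p * (u ^+ 3 * d / 2) = u ^+ 4 * (p * d) - u ^+ 2 * tau by rewrite /tau; field.
  have -> : u * p * (n * Gm) = u * (p * n) * Gm by ring.
  lra.
(* A vertex with many good partners: the elements [(f a0)^-1 * f b] lie in [S], so the left coset of
   [S] by [f a0] has large mass. *)
have [a0 ha0] : exists a, u ^+ 3 * d / (2 * n ^+ 2) <= \sum_b (good a b)%:R.
  apply: exists_ge_mean => //; rewrite -/n -(ler_pM2l n0); apply: le_trans many.
  by rewrite le_eqVlt; apply/orP; left; apply/eqP; field.
pose S := [seq ((f q.1)^-1 * f q.2)%g | q <- enum [set q | good q.1 q.2]].
have SP s : reflect (exists a b, good a b /\ s = ((f a)^-1 * f b)%g) (s \in S).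
  apply: (iffP mapP) => [[[a b]]|[a [b [gab ->]]]].
    by rewrite mem_enum inE /= => gab ->; exists a, b.
  by exists (a, b); rewrite ?mem_enum ?inE.
(* A lower bound for the number of distinct [f c] in the representations of an element of [S]: at
   least [tau / (p * n)] indices [c] occur, and each value is shared by at most [p * n] of them. *)
pose t := d / (128 * K ^+ 2) / p.
exists S; split.
- move=> s /SP[a [b [gab ->]]]; apply/SP; exists b, a; split; first by rewrite goodC.
  by rewrite invgM invgK.
- exists (f a0); apply: le_trans (_ : \sum_b (good a0 b)%:R <= _); last first.
    rewrite sum_natr_bool ler_nat subset_leq_card //; apply/subsetP => b; rewrite !inE => gb.
    by apply/SP; exists a0, b.
  apply: le_trans ha0; rewrite ler_pdivlMr ?mulr_gt0 ?exprn_gt0 //.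
  have -> : n / (2 ^+ 31 * K ^+ 12) * (2 * n ^+ 2) = (n / (8 * K)) ^+ 3 * d by rewrite /d; field.
  by rewrite ler_pM2r // lerXn2r ?nnegrE ?(ltW u0).
- pose ZZ m g := exists x z y, [/\ x \in U, y \in U, word S m z & g = (f x * z / f y)%g].
  have t_le a b : good a b ->
      t <= (size (undup [seq f c | c <- enum [set c in U | [exists x in U, (f c / f a)%g == (f x / f b)%g]]]))%:R.
    move=> /and3P[_ _ gab]; set C := [set c in U | _].
    have tC : tau <= #|C|%:R * (p * n).
      apply: le_trans gab _; rewrite /qn -sum1_card natr_sum mulr_suml big_mkcond [leRHS]big_mkcond.
      apply: ler_sum => c _; rewrite /C inE; case: (c \in U) => //=.
      case: ifP => [_|/negbT]; first by rewrite mul1r.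
      rewrite negb_exists => /forallP hx; rewrite big1 // => x xU.
      by have := hx x; rewrite xU /= => /negbTE ->.
    apply: le_trans (card_le_values (c := tau / (p * n ^+ 2)) _); last first.
      apply: le_trans (_ : tau / (p * n) <= _); last by rewrite ler_pdivrMr ?mulr_gt0.
      by rewrite le_eqVlt; apply/orP; left; apply/eqP; field; rewrite pn0 nn0.
    rewrite /t ler_pM2r ?invr_gt0 // ler_pdivlMr ?mulr_gt0 ?exprn_gt0 //.
    have -> : d / (128 * K ^+ 2) * (p * n ^+ 2) = (n / (8 * K)) ^+ 2 * (p * d / 2) by field.
    have -> : tau = u ^+ 2 * (p * d / 2) by rewrite /tau; field.
    by rewrite ler_pM2r ?divr_gt0 ?mulr_gt0 // lerXn2r ?nnegrE ?(ltW u0).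
  pose H := [seq phi q | q : V * V].
  have c0 m : 0 <= (t * (p * d)) ^+ m * (p * d).
    have t0 : 0 < t by rewrite /t !divr_gt0 ?mulr_gt0 ?exprn_gt0.
    have pd0 : 0 < p * d by rewrite mulr_gt0.
    by have pd1 := ltW pd0; rewrite mulr_ge0 // exprn_ge0 // mulr_ge0 // ltW.
  have popZ m : popular ((t * (p * d)) ^+ m * (p * d)) (ZZ m).
    elim: m => [|m IH].
      rewrite expr0 mul1r; have [w [w1 w2]] := popD; exists w; split => // g.
      move=> [x [z [y [xU yU -> ->]]]]; apply: w2; exists x, y; split => //.
      by rewrite mulg1.
    have -> : (t * (p * d)) ^+ m.+1 * (p * d) = t * ((p * d) * ((t * (p * d)) ^+ m * (p * d))).
      by rewrite exprS; ring.
    apply: (popular_conv (H := H) _ (c0 m) popD IH); first by rewrite mulr_ge0 ?ltW.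
    (* With [(f a)^-1 * f b = (f c)^-1 * f e], the element splits as [f x / f c] times
       [f e * z' / f y]; the second factor involves one letter less. *)
    move=> g [x [z [y [xU yU [s [z' [/SP[a [b [gab ->]]] wz' ->]]] ->]]]].
    have := t_le _ _ gab; set l := undup _ => tl.
    exists [seq (f x / h)%g | h <- l]; split.
    + by rewrite map_inj_uniq ?undup_uniq // => h h' /mulgI; exact: invg_inj.
    + move=> _ /mapP[h + ->]; rewrite mem_undup => /mapP[c _ ->].
      by apply/codomP; exists (x, c).
    + by rewrite size_map.
    + move=> _ /mapP[h + ->]; rewrite mem_undup => /mapP[c + ->].
      rewrite mem_enum inE => /andP[cU /existsP[e /andP[eU /eqP he]]].
      split; first by exists x, c.
      exists e, z', y; split => //.
      have -> : f e = (f c / f a * f b)%g by rewrite he mulgVK.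
      by rewrite invgF !mulgA mulgVK.
  move=> m Z uZ ZW; have [x xU] : exists x, x \in U.
    by apply/set0Pn; rewrite -card_gt0 -(ltr_nat F).
  (* Conjugation by a single [f x] carries words in [S] injectively into [ZZ m]. *)
  pose Z' := [seq (f x * z / f x)%g | z <- Z].
  have uZ' : uniq Z' by rewrite map_inj_uniq // => z z' /divIg/mulgI.
  have := popular_size (popZ m) uZ' _; rewrite size_map => h.
  apply: le_trans (h _); last by move=> _ /mapP[z zZ ->]; exists x, z, x; split => //; exact: ZW.
  apply: ler_wpM2l => //.
  have -> : t * (p * d) = (2 ^+ 49 * K ^+ 20)^-1 by rewrite /t /d; field; rewrite pn0 Kn0.
  set k := 2 ^+ 49 * K ^+ 20; have k0 : 0 < k by rewrite mulr_gt0 ?exprn_gt0.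
  have -> : p / k ^+ m.+1 = k^-1 ^+ m * (p * k^-1) by rewrite exprSr invfM -exprVn; ring.
  apply: ler_wpM2l; first by rewrite exprn_ge0 ?invr_ge0 ?ltW.
  rewrite ler_pM2l // lef_pV2 ?posrE ?mulr_gt0 ?exprn_gt0 //.
  by apply: ler_pM; rewrite ?exprn_ge0 ?(ltW K0) // ler_weXn2l // ler1n.
Qed.

End BalogSzemerediGowers.

(** * The affine group and growth of its subsets *)

Section AffineGroup.
Variable F : fieldType.

Record aff := Aff { aff_val : F * F; slope_neq0 : aff_val.1 != 0 }.

HB.instance Definition _ := [isSub for aff_val].
HB.instance Definition _ := [Choice of aff by <:].

Definition slope g := (aff_val g).1.
Definition shift g := (aff_val g).2.
Definition act g x := slope g * x + shift g.

Definition translation t := @Aff (1, t) (oner_neq0 F).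

Definition aff_mul g h :=
  @Aff (slope g * slope h, act g (shift h)) (mulf_neq0 (slope_neq0 g) (slope_neq0 h)).

Fact aff_inv_subproof g : ((slope g)^-1, - (shift g / slope g)).1 != 0.
Proof. by rewrite invr_eq0 slope_neq0. Qed.

Definition aff_inv g := Aff (aff_inv_subproof g).

Lemma aff_eq g h : slope g = slope h -> shift g = shift h -> g = h.
Proof.
move=> hs ht; apply: val_inj; rewrite /= (surjective_pairing (aff_val g)).
by rewrite (surjective_pairing (aff_val h)); congr (_, _).
Qed.

Let slope_mul g h : slope (aff_mul g h) = slope g * slope h. Proof. by []. Qed.
Let shift_mul g h : shift (aff_mul g h) = slope g * shift h + shift g. Proof. by []. Qed.
Let slope_tr t : slope (translation t) = 1. Proof. by []. Qed.
Let shift_tr t : shift (translation t) = t. Proof. by []. Qed.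
Let slope_inv g : slope (aff_inv g) = (slope g)^-1. Proof. by []. Qed.
Let shift_inv g : shift (aff_inv g) = - (shift g / slope g). Proof. by []. Qed.
Let affE := (slope_mul, shift_mul, slope_tr, shift_tr, slope_inv, shift_inv).

Fact aff_mulA : associative aff_mul.
Proof. by move=> g h k; apply: aff_eq; rewrite !affE; ring. Qed.

Fact aff_1mul : left_id (translation 0) aff_mul.
Proof. by move=> g; apply: aff_eq; rewrite !affE; ring. Qed.

Fact aff_mul1 : right_id (translation 0) aff_mul.
Proof. by move=> g; apply: aff_eq; rewrite !affE; ring. Qed.

Fact aff_mulV : left_inverse (translation 0) aff_inv aff_mul.
Proof. by move=> g; apply: aff_eq; rewrite !affE; field; exact: slope_neq0. Qed.

Fact aff_Vmul : right_inverse (translation 0) aff_inv aff_mul.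
Proof. by move=> g; apply: aff_eq; rewrite !affE; field; exact: slope_neq0. Qed.

HB.instance Definition _ := isGroup.Build aff aff_mulA aff_1mul aff_mul1 aff_mulV aff_Vmul.

Lemma slopeM g h : slope (g * h)%g = slope g * slope h. Proof. by []. Qed.
Lemma slopeV g : slope g^-1%g = (slope g)^-1. Proof. by []. Qed.
Lemma shiftM g h : shift (g * h)%g = slope g * shift h + shift g. Proof. by []. Qed.
Lemma shiftV g : shift g^-1%g = - (shift g / slope g). Proof. by []. Qed.

Lemma actM g h x : act (g * h)%g x = act g (act h x).
Proof. by rewrite /act slopeM shiftM; ring. Qed.

Lemma act1 x : act 1%g x = x.
Proof. by rewrite /act -[slope 1%g]/1 -[shift 1%g]/0; ring. Qed.

Lemma actK g x : act g^-1%g (act g x) = x. Proof. by rewrite -actM mulVg act1. Qed.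
Lemma actVK g x : act g (act g^-1%g x) = x. Proof. by rewrite -actM mulgV act1. Qed.

Lemma translationD s t : translation (s + t) = (translation s * translation t)%g.
Proof. by apply: aff_eq; rewrite ?slopeM ?shiftM !affE; ring. Qed.

Lemma translationN t : translation (- t) = (translation t)^-1%g.
Proof. by apply: aff_eq; rewrite ?slopeV ?shiftV !affE ?invr1 ?mulr1. Qed.

(** Conjugation acts on translations as multiplication by the slope; this is how products and sums
    of slopes come to appear as translations. *)
Lemma translationJ g t : (g * translation t * g^-1)%g = translation (slope g * t).
Proof.
by apply: aff_eq; rewrite ?slopeM ?shiftM ?slopeV ?shiftV ?slopeM !affE; field; exact: slope_neq0.
Qed.

Lemma slope_eq1 g : slope g = 1 -> g = translation (shift g).
Proof. by move=> s1; apply: aff_eq. Qed.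

Lemma aff_eq_2points g h x x' : x != x' -> act g x = act h x -> act g x' = act h x' -> g = h.
Proof.
move=> xx' e e'; have hs : slope g = slope h.
  have x0 : x - x' != 0 by rewrite subr_eq0.
  apply: (mulIf x0); move: e e'; rewrite /act => e e'.
  by transitivity ((slope g * x + shift g) - (slope g * x' + shift g)); [|rewrite e e']; ring.
by apply: aff_eq => //; move: e; rewrite /act hs => /addrI.
Qed.

End AffineGroup.

(** Multiplication by a slope costs a factor 3 in word length, a quadratic polynomial turns a factor
    [m] into [6 * m ^ 2], and the translation that is multiplied is a commutator, of length 4. *)
Definition growth_length j : nat := (iter j (fun m => 6 * m ^ 2) 3 * 4)%N.

Section Growth.
Variable F : realFieldType.

(* The largest element q of (X - X)/(X - X) is such that q + 1 is not in this
   set, which makes (u, v) |-> u + (q + 1) v injective on X * X. *)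
Lemma quadratic_growth (X : seq F) : uniq X -> (1 < size X)%N ->
  exists a b c d, [/\ a \in X, b \in X, c \in X & d \in X] /\
    uniq [seq (c - d) * u + (a - b + (c - d)) * v | u <- X, v <- X].
Proof.
move=> uX X1.
pose quot (q : F * F * (F * F)) := (q.1.1 - q.1.2) / (q.2.1 - q.2.2).
pose XX := [seq (u, v) | u <- X, v <- X].
pose Q := [seq q <- [seq (u, v) | u <- XX, v <- XX] | q.2.1 != q.2.2].
have QP a b c d : a \in X -> b \in X -> c \in X -> d \in X -> c != d -> ((a, b), (c, d)) \in Q.
  move=> aX bX cX dX cd; rewrite mem_filter /= cd /=.
  by apply/allpairsP; exists ((a, b), (c, d)); split => //=; apply/allpairsP; [exists (a, b)|exists (c, d)].
have [q qQ qmax] : exists2 q, q \in Q & forall q', q' \in Q -> quot q' <= quot q.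
  have [q0 q0Q] : exists q, q \in Q.
    exists ((X`_0, X`_0), (X`_0, X`_1)).
    by apply: QP; rewrite ?mem_nth ?nth_uniq // ltnW.
  elim: Q q0 q0Q {QP} => [//|q Q IH] q0 _.
  case: Q IH => [|q1 Q] IH.
    by exists q; rewrite ?mem_head // => q'; rewrite inE => /eqP ->.
  have [q2 q2Q hq2] := IH q1 (mem_head _ _).
  case: (leP (quot q) (quot q2)) => h.
    exists q2; first by rewrite inE q2Q orbT.
    by move=> q'; rewrite inE => /orP[/eqP ->//|/hq2].
  exists q; first exact: mem_head.
  by move=> q'; rewrite inE => /orP[/eqP ->//|/hq2 /le_trans ->//]; exact: ltW.
case: q qQ qmax => -[a b] [c d]; rewrite mem_filter /= => /andP[cd].
move=> /allpairsP[[[? ?] [? ?]] /= [/allpairsP[[a' b'] /= [aX bX [-> ->]]] /allpairsP[[c' d'] /= [cX dX [-> ->]]]]].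
move=> [? ? ? ?]; subst a' b' c' d' => qmax.
have cd0 : c - d != 0 by rewrite subr_eq0.
exists a, b, c, d; split=> //; apply: allpairs_uniq => //.
move=> _ _ /allpairsP[[u v] /= [uX' vX ->]] /allpairsP[[u' v'] /= [u'X v'X ->]] /= h.
have [vv|vv] := eqVneq v v'.
  move: h; rewrite vv => /addIr/(mulfI cd0) -> //.
(* If [v] and [v'] differ, the collision exhibits the maximal quotient plus 1 as a quotient of
   differences. *)
have := qmax _ (QP _ _ _ _ u'X uX' vX v'X vv); rewrite /quot /=.
have v0 : v - v' != 0 by rewrite subr_eq0.
have -> : (u' - u) / (v - v') = (a - b) / (c - d) + 1.
  apply: (mulIf v0); apply: (mulIf cd0); rewrite mulfVK //.
  have -> : ((a - b) / (c - d) + 1) * (v - v') * (c - d) = (a - b + (c - d)) * (v - v') by field.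
  apply/eqP; rewrite -subr_eq0; move/eqP: h; rewrite -subr_eq0 => /eqP h.
  by rewrite -oppr_eq0 -[X in _ == X]h; apply/eqP; ring.
by rewrite gerDl ler10.
Qed.

Variable S : seq (aff F).
Hypothesis Sinv : forall s, s \in S -> s^-1%g \in S.

Lemma word_cat m k z z' : word S m z -> word S k z' -> word S (m + k) (z * z')%g.
Proof.
elim: m z => [|m IH] z /=; first by move=> ->; rewrite mul1g.
by move=> [s [y [sS wy ->]]] wz'; exists s, (y * z')%g; split; rewrite ?mulgA //; exact: IH.
Qed.

Lemma word1 s : s \in S -> word S 1 s.
Proof. by move=> sS; exists s, 1%g; rewrite mulg1. Qed.

Lemma wordV m z : word S m z -> word S m z^-1%g.
Proof.
elim: m z => [|m IH] z /=; first by move=> ->; rewrite invg1.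
move=> [s [y [sS /IH wy ->]]]; rewrite invgM.
by have := word_cat wy (word1 (Sinv sS)); rewrite addn1.
Qed.

(** The cost is a factor on the length, uniform in the translation, so that costs add for sums of
    multipliers and multiply for products. *)
Definition multiplier m r := forall k t, (0 < k)%N ->
  word S k (translation t) -> word S (m * k) (translation (r * t)).

Lemma multiplierB m m' r r' :
  multiplier m r -> multiplier m' r' -> multiplier (m + m') (r - r').
Proof.
move=> h h' k t k0 wt; rewrite mulrBl translationD translationN mulnDl.
by apply: word_cat; [exact: h|apply: wordV; exact: h'].
Qed.

Lemma multiplierD m m' r r' :
  multiplier m r -> multiplier m' r' -> multiplier (m + m') (r + r').
Proof.
move=> h h' k t k0 wt; rewrite mulrDl translationD mulnDl.
by apply: word_cat; [exact: h|exact: h'].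
Qed.

Lemma multiplierM m m' r r' : (0 < m')%N ->
  multiplier m r -> multiplier m' r' -> multiplier (m * m') (r * r').
Proof.
move=> m0 h h' k t k0 wt; rewrite -mulrA -mulnA; apply: h; first by rewrite muln_gt0 m0.
exact: h'.
Qed.

(** Conjugation by [s] gives length [k + 2]; inserting [k - 1] trivial pairs [s * s^-1] pads it to
    [3 * k]. *)
Lemma multiplier_slope s : s \in S -> multiplier 3 (slope s).
Proof.
move=> sS k t k0 wt; rewrite -translationJ.
have -> : (3 * k = (1 + k + 1) + (k.-1).*2)%N by lia.
rewrite -[X in word _ _ X]mulg1; apply: word_cat.
  by apply: word_cat; [apply: word_cat => //; exact: word1|apply: word1; exact: Sinv].
elim: (k.-1) => [//|j IH]; rewrite doubleS /=.
exists s, (s^-1)%g; split=> //; last by rewrite mulgV.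
exists (s^-1)%g, 1%g; split=> //; [exact: Sinv|by rewrite mulg1].
Qed.

Lemma iterated_growth (X : seq F) m j : uniq X -> (1 < size X)%N -> (0 < m)%N ->
  (forall x, x \in X -> multiplier m x) ->
  exists Y, [/\ uniq Y, size Y = (size X ^ (2 ^ j))%N &
    forall y, y \in Y -> multiplier (iter j (fun m => 6 * m ^ 2) m)%N y].
Proof.
move=> uX X1 m0 Xm; elim: j => [|j [Y [uY sY Ym]]]; first by exists X.
have Y1 : (1 < size Y)%N by apply: (leq_trans X1); rewrite sY -{1}(expn1 (size X)) leq_exp2l // expn_gt0.
have [a [b [c [d [[aY bY cY dY] uZ]]]]] := quadratic_growth uY Y1.
exists [seq (c - d) * u + (a - b + (c - d)) * v | u <- Y, v <- Y]; split => //.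
  by rewrite size_allpairs sY -expnD addnn -mul2n -expnS.
move=> _ /allpairsP[[u v] /= [uY' vY ->]].
set M := iter j _ m in Ym *.
have M0 : (0 < M)%N by rewrite /M; elim: (j) => //= i; rewrite muln_gt0 expn_gt0 => ->.
(* The cost of the polynomial: [c - d] takes [M + M], the coefficient of [v] twice that, and the
   multiplication by [u] or [v] a factor [M]. *)
have -> : (6 * M ^ 2 = (M + M) * M + ((M + M) + (M + M)) * M)%N by lia.
apply: multiplierD; apply: multiplierM => //; try exact: Ym.
  by apply: multiplierB; exact: Ym.
by apply: multiplierD; apply: multiplierB; exact: Ym.
Qed.

(** The commutator of [s] and [s'] has slope 1 and is not the identity, so it is a nonzero
    translation; multiplying it by the elements that iterated growth builds from the slopes gives
    distinct translations. *)
Lemma word_growth j s s' : s \in S -> s' \in S -> (s * s')%g != (s' * s)%g ->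
  (1 < size (undup [seq slope s | s <- S]))%N ->
  exists Z, [/\ uniq Z, size Z = (size (undup [seq slope s | s <- S]) ^ (2 ^ j))%N &
    forall z, z \in Z -> word S (growth_length j) z].
Proof.
move=> sS s'S ss' X1.
have [Y [uY sY Ym]] : exists Y, [/\ uniq Y, size Y = (size (undup [seq slope s | s <- S]) ^ (2 ^ j))%N &
    forall y, y \in Y -> multiplier (iter j (fun m => 6 * m ^ 2) 3)%N y].
  apply: iterated_growth; rewrite ?undup_uniq // => x.
  by rewrite mem_undup => /mapP[g gS ->]; exact: multiplier_slope.
pose g := (s * s' * (s^-1 * s'^-1))%g.
have gE : g = translation (shift g).
  by apply: slope_eq1; rewrite !slopeM !slopeV; field; rewrite !slope_neq0.
have g0 : shift g != 0.
  apply: contra ss' => /eqP g0; move: gE; rewrite g0 /g -invgM => h.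
  by rewrite -[(s * s')%g](mulgVK (s' * s)%g) h mul1g.
have wg : word S 4 (translation (shift g)).
  rewrite -gE /g; apply: (word_cat (m := 2) (k := 2)); apply: (word_cat (m := 1) (k := 1)); apply: word1 => //; exact: Sinv.
exists [seq translation (y * shift g) | y <- Y]; split.
- rewrite map_inj_uniq // => y y' /(congr1 (@shift F)); exact: mulIf.
- by rewrite size_map.
- by move=> _ /mapP[y yY ->]; exact: Ym.
Qed.

End Growth.

(** * Random walks *)

(** A random walk of fixed length is modelled by the finite set of its equally likely paths. The
    involution [reverse] expresses that the law of the endpoint is symmetric. *)
Record walk (G : groupType) := Walk {
  steps :> finType;
  endpoint : steps -> G;
  reverse : steps -> steps;
  reverseK : involutive reverse;
  endpoint_reverse : forall v, endpoint (reverse v) = (endpoint v)^-1%g }.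

Section Walks.
Variables (F : realFieldType) (G : groupType).
Implicit Type w : walk G.

Definition double_reverse w (q : w * w) := (reverse q.2, reverse q.1).

Fact double_reverseK w : involutive (@double_reverse w).
Proof. by move=> [u v]; rewrite /double_reverse /= !reverseK. Qed.

Fact double_endpoint_reverse w (q : w * w) :
  (endpoint (reverse q.2) * endpoint (reverse q.1) = (endpoint q.1 * endpoint q.2)^-1)%g.
Proof. by rewrite !endpoint_reverse invgM. Qed.

Definition double_walk w : walk G :=
  @Walk G (w * w)%type (fun q => endpoint q.1 * endpoint q.2)%g
    (@double_reverse w) (@double_reverseK w) (@double_endpoint_reverse w).

Definition hits w g : F := #|[set v : w | endpoint v == g]|%:R.
Definition return_prob w : F := hits w 1%g / #|w|%:R.

Lemma hits_ge0 w g : 0 <= hits w g. Proof. exact: ler0n. Qed.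

Lemma hitsV w g : hits w g^-1%g = hits w g.
Proof.
congr _%:R; rewrite -(card_imset _ (can_inj (@reverseK _ w))); congr #|pred_of_set _|.
apply/setP => v; apply/imsetP/idP => [[u + ->]|].
  by rewrite !inE endpoint_reverse => /eqP ->; rewrite invgK.
rewrite inE => /eqP <-; exists (reverse v); rewrite ?reverseK // inE.
by rewrite endpoint_reverse.
Qed.

Lemma hits_double w g :
  hits (double_walk w) g = \sum_(u : w) hits w ((endpoint u)^-1 * g)%g.
Proof.
rewrite /hits -sum_natr_bool.
rewrite -(pair_big predT predT (fun x y : w => ((endpoint x * endpoint y)%g == g)%:R : F)) /=.
apply: eq_bigr => u _; rewrite sum_natr_bool; congr _%:R; apply: eq_card => v; rewrite !inE.
by rewrite -(inj_eq (mulgI (endpoint u)^-1%g)) mulKg.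
Qed.

Lemma sum_endpoint w (h : G -> F) :
  \sum_(v : w) h (endpoint v) =
  \sum_(g <- undup [seq endpoint v | v : w]) hits w g * h g.
Proof.
set s := undup _.
have vs (v : w) : endpoint v \in s by rewrite mem_undup; apply/codomP; exists v.
transitivity (\sum_(v : w) \sum_(g <- s) (endpoint v == g)%:R * h g).
  apply: eq_bigr => v _.
  have e : \sum_(g <- s) (endpoint v == g)%:R = 1 :> F by rewrite sum_eq_seq ?undup_uniq // vs.
  rewrite -[LHS]mul1r -[X in X * h _ = _]e mulr_suml; apply: eq_bigr => g _.
  by case: eqP => [->//|_]; rewrite !mul0r.
by rewrite exchange_big /=; apply: eq_bigr => g _; rewrite -mulr_suml sum_natr_bool.
Qed.

(** By symmetry the value at 1 is the sum of the squares of [hits w]; any other value is a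
    correlation of [hits w] with a rearrangement of itself, and [2ab <= a^2 + b^2] applies. *)
Lemma hits_double_le w g : hits (double_walk w) g <= hits (double_walk w) 1%g.
Proof.
rewrite !hits_double.
rewrite (sum_endpoint w (fun h => hits w (h^-1 * g)%g)).
rewrite (sum_endpoint w (fun h => hits w (h^-1 * 1)%g)); set s := undup _.
have -> : \sum_(h <- s) hits w h * hits w (h^-1 * 1)%g = \sum_(h <- s) hits w h ^+ 2.
  by apply: eq_bigr => h _; rewrite mulg1 hitsV expr2.
have h1 : \sum_(h <- s) hits w (h^-1 * g)%g ^+ 2 <= \sum_(h <- s) hits w h ^+ 2.
  rewrite -(big_map (fun h => h^-1 * g)%g predT (fun h => hits w h ^+ 2)).
  rewrite (bigID (mem s)) /= [X in _ + X]big1 ?addr0 => [|h hs]; last first.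
    rewrite /hits (_ : [set v | _] = set0) ?cards0 ?expr0n //.
    apply/setP => v; rewrite !inE; apply: contraNF hs => /eqP <-.
    by rewrite mem_undup; apply/codomP; exists v.
  rewrite -big_filter; apply: ler_sum_subseq => [h|||h]; rewrite ?sqr_ge0 ?undup_uniq ?mem_filter //.
  - rewrite filter_uniq // map_inj_uniq ?undup_uniq // => h h1 /mulIg; exact: invg_inj.
  - by case/andP.
have h2 : 2 * \sum_(h <- s) hits w h * hits w (h^-1 * g)%g <=
    \sum_(h <- s) hits w h ^+ 2 + \sum_(h <- s) hits w (h^-1 * g)%g ^+ 2.
  rewrite -big_split mulr_sumr; apply: ler_sum => h _.
  by have := sqr_ge0 (hits w h - hits w (h^-1 * g)%g); rewrite /=; nra.
lra.
Qed.

(** By symmetry of the walk, quotients of endpoints are distributed like endpoints of the doubled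
    walk. The energy hypothesis of [approximate_group] thus becomes a return probability at four
    times the length. *)
Lemma energy_walk w :
  \sum_(x : w) \sum_(y : w)
     law F (fun q : w * w => (endpoint q.1 / endpoint q.2)%g) (endpoint x / endpoint y)%g =
  #|w|%:R ^+ 2 * return_prob (double_walk (double_walk w)).
Proof.
have [w0|w0] := posnP #|w|.
  rewrite w0 expr0n mul0r big1 // => x _.
  by have := fintype0 x w0.
have n0 : #|w|%:R != 0 :> F by rewrite pnatr_eq0 -lt0n.
rewrite /return_prob /= !card_prod !natrM.
have -> : #|w|%:R ^+ 2 * (hits (double_walk (double_walk w)) 1%g / (#|w|%:R * #|w|%:R * (#|w|%:R * #|w|%:R))) =
   hits (double_walk (double_walk w)) 1%g / (#|w|%:R * #|w|%:R) by field.
rewrite hits_double /=.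
rewrite -(pair_big predT predT (fun x y : w => hits (double_walk w) ((endpoint x * endpoint y)^-1 * 1)%g)) /=.
rewrite mulr_suml; apply: eq_bigr => x _.
rewrite mulr_suml (reindex_inj (can_inj (@reverseK _ w))) /=; apply: eq_bigr => y _.
rewrite /law card_prod natrM; congr (_ / _).
rewrite endpoint_reverse mulg1 invgM -[hits _ _]hitsV invgM !invgK.
have rK := @reverseK _ w.
have rI : injective (fun q : w * w => (q.1, reverse q.2)).
  by move=> [a b] [c d] [-> /(can_inj rK) ->].
rewrite /hits -[in RHS](card_imset _ rI); congr _%:R; congr #|pred_of_set _|.
apply/setP => -[u v]; rewrite inE /=; apply/idP/imsetP => [/eqP h|[[u' v']]].
  exists (u, reverse v); last by rewrite rK.
  by rewrite inE /= endpoint_reverse h.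
by rewrite inE /= => /eqP h [-> ->]; rewrite endpoint_reverse invgK h.
Qed.

Lemma return_prob_le1 w : return_prob w <= 1.
Proof.
rewrite /return_prob; have [w0|w0] := posnP #|w|; first by rewrite w0 invr0 mulr0.
by rewrite ler_pdivrMr ?ltr0n // mul1r ler_nat max_card.
Qed.

Lemma card_iter_double w j : (0 < #|w|)%N -> (0 < #|iter j double_walk w|)%N.
Proof. by move=> w0; elim: j => //= j IH; rewrite card_prod muln_gt0 IH. Qed.

(** Otherwise each of the [I] quadruplings, made of two doublings each, would lose more than a
    factor [K], starting from a probability at most 1. *)
Lemma stationary_scale w (K : F) I : 0 < K ->
  K^-1 ^+ I <= return_prob (iter I.*2 double_walk w) -> (0 < I)%N ->
  exists2 i, (i < I)%N &
    return_prob (iter i.*2 double_walk w) / K <= return_prob (iter i.+1.*2 double_walk w).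
Proof.
move=> K0 hI I0; apply: contrapT => hn.
have dec i : (i <= I)%N -> (0 < i)%N -> return_prob (iter i.*2 double_walk w) < K^-1 ^+ i.
  elim: i => // i IH iI _; have step : return_prob (iter i.+1.*2 double_walk w) < return_prob (iter i.*2 double_walk w) / K.
    by rewrite ltNge; apply/negP => h; apply: hn; exists i.
  apply: lt_le_trans step _; rewrite exprSr ler_pM2r ?invr_gt0 //.
  case: i IH iI => [|i] IH iI; first by rewrite expr0 return_prob_le1.
  by rewrite ltW // IH // ltnW.
by have := lt_le_trans (dec I (leqnn I) I0) hI; rewrite ltxx.
Qed.

End Walks.

(** * Affine maps sending many points of a finite set into itself *)

Section RichMaps.
Variable F : realFieldType.

Definition base_walk (G : groupType) (I : finType) (l : I -> G) : walk G.
Proof.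
refine (@Walk G (I * I)%type (fun q => l q.1 / l q.2)%g (fun q => (q.2, q.1)) _ _).
- by move=> [].
- by move=> q; rewrite /= invgF.
Defined.

Lemma card_prod_lel (V W : finType) (B : pred (V * W)) (c : F) :
  (forall u, #|[set v | B (u, v)]|%:R <= c) -> #|[set q | B q]|%:R <= #|V|%:R * c.
Proof.
move=> h; rewrite -sum_natr_bool (eq_bigr (fun q => (B (q.1, q.2))%:R)) => [|[? ?]] //.
rewrite -(pair_bigA _ (fun u v => (B (u, v))%:R : F)) /=.
by rewrite -sum_cst; apply: ler_sum => u _; rewrite sum_natr_bool.
Qed.

Lemma card_prod_ler (V W : finType) (B : pred (V * W)) (c : F) :
  (forall v, #|[set u | B (u, v)]|%:R <= c) -> #|[set q | B q]|%:R <= #|W|%:R * c.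
Proof.
move=> h; rewrite -sum_natr_bool (eq_bigr (fun q => (B (q.1, q.2))%:R)) => [|[? ?]] //.
rewrite -(pair_bigA _ (fun u v => (B (u, v))%:R : F)) /=.
by rewrite exchange_big -sum_cst; apply: ler_sum => v _; rewrite sum_natr_bool.
Qed.

(** This bound and the next one record that the walk is spread out. Both survive doubling; later
    they show that [S] has many slopes and does not fix a point. *)
Definition slope_mass_le (q : F) (w : walk (aff F)) := forall s,
  #|[set v : w | slope (endpoint v) == s]|%:R <= q * #|w|%:R.

Definition orbit_mass_le (q : F) (w : walk (aff F)) := forall x y,
  #|[set v : w | act (endpoint v) x == y]|%:R <= q * #|w|%:R.

Lemma slope_mass_double q w : slope_mass_le q w -> slope_mass_le q (double_walk w).
Proof.
move=> h s; rewrite /= card_prod natrM mulrCA; apply: card_prod_lel => u /=.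
apply: le_trans (h (s / slope (endpoint u))).
rewrite ler_nat subset_leq_card //; apply/subsetP => v; rewrite !inE slopeM => /eqP <-.
by rewrite mulrAC mulfV ?mul1r // slope_neq0.
Qed.

(** In a product the second factor acts first; once it is fixed, the bound applies to the first
    factor at the image of [x]. *)
Lemma orbit_mass_double q w : orbit_mass_le q w -> orbit_mass_le q (double_walk w).
Proof.
move=> h x y; rewrite /= card_prod natrM mulrCA; apply: card_prod_ler => v /=.
apply: le_trans (h (act (endpoint v) x) y).
by rewrite ler_nat subset_leq_card //; apply/subsetP => u; rewrite !inE actM.
Qed.

Section Base.
Variables (I : finType) (l : I -> aff F).
Hypothesis I0 : (0 < #|I|)%N.
Let N : F := #|I|%:R.
Let N0 : N != 0. Proof. by rewrite pnatr_eq0 -lt0n. Qed.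

Lemma slope_mass_base : injective (fun i => slope (l i)) ->
  slope_mass_le N^-1 (base_walk l).
Proof.
move=> linj s; rewrite /= card_prod natrM -/N mulKf // -[leRHS]mulr1.
apply: card_prod_ler => i /=.
rewrite (ler_nat _ _ 1); apply/card_le1_eqP => a b; rewrite !inE => /eqP ha /eqP hb.
have s0 : (slope (l i))^-1 != 0 by rewrite invr_eq0 slope_neq0.
by apply: linj; apply: (mulIf s0); move: ha; rewrite -hb /= !slopeM.
Qed.

Lemma orbit_mass_base : (forall x y, (#|[set i | act (l i) x == y]| <= 2)%N) ->
  orbit_mass_le (2 / N) (base_walk l).
Proof.
move=> l2 x y; rewrite /= card_prod natrM -/N -mulrA mulKf // mulrC.
apply: card_prod_ler => i /=; rewrite (ler_nat _ _ 2).
by apply: leq_trans (l2 (act (l i)^-1%g x) y); rewrite subset_leq_card //; apply/subsetP => a; rewrite !inE actM.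
Qed.
End Base.

Section Richness.
Variable A : seq F.
Hypotheses (uA : uniq A) (A0 : (0 < size A)%N).
Let n : F := (size A)%:R.
Let n0 : 0 < n. Proof. by rewrite ltr0n. Qed.

(** In terms of incidences, the number of points of the grid [A] x [A] on the graph of [g]. *)
Definition richness (g : aff F) : F := \sum_(x <- A) (act g x \in A)%:R.

(** Substitute [y = act h x]: each [x] counted on the left gives a point [y] of [A] that [g / h]
    sends into [A]. *)
Lemma richness_quotient g h :
  \sum_(x <- A) ((act g x \in A) && (act h x \in A))%:R <= richness (g / h)%g.
Proof.
under eq_bigr do rewrite andbC -mulnb natrM.
pose B := [seq act h x | x <- A & act h x \in A].
have hI : injective (act h) by apply: (can_inj (g := act h^-1%g)) => x; exact: actK.
have -> : \sum_(x <- A) (act h x \in A)%:R * (act g x \in A)%:R =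
          \sum_(y <- B) (act (g / h)%g y \in A)%:R :> F.
  rewrite big_map big_filter [RHS]big_mkcond; apply: eq_bigr => x _.
  by rewrite actM actK; case: (act h x \in A); rewrite ?mul1r ?mul0r.
have hp : perm_eq B [seq y <- A | y \in B].
  apply: uniq_perm; rewrite ?filter_uniq ?map_inj_uniq ?filter_uniq // => y.
  rewrite mem_filter; case: (boolP (y \in B)) => // /mapP[x + ->].
  by rewrite mem_filter => /andP[].
rewrite (perm_big _ hp) big_filter big_mkcond; apply: ler_sum => y _.
by case: ifP.
Qed.

(** Cauchy-Schwarz over [x] in [A], for the number [d x] of maps sending [x] into [A]. *)
Lemma sum_richness_quotients (I : finType) (l : I -> aff F) :
  (\sum_i richness (l i)) ^+ 2 <= n * \sum_i \sum_j richness (l i / l j)%g.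
Proof.
pose d x : F := \sum_i (act (l i) x \in A)%:R.
have -> : \sum_i richness (l i) = \sum_(x <- A) d x by rewrite exchange_big.
have := cauchy_schwarz_sum A predT d; rewrite count_predT => /le_trans; apply.
rewrite ler_pM2l //.
have -> : \sum_(x <- A) d x ^+ 2 = \sum_i \sum_j \sum_(x <- A)
    ((act (l i) x \in A) && (act (l j) x \in A))%:R.
  rewrite exchange_big /= (eq_bigr (fun j => \sum_(x <- A) \sum_i
    ((act (l i) x \in A) && (act (l j) x \in A))%:R)); last by move=> j _; rewrite exchange_big.
  rewrite exchange_big /=; apply: eq_bigr => x _.
  rewrite expr2 mulr_sumr; apply: eq_bigr => j _; rewrite mulr_suml.
  by apply: eq_bigr => i _; rewrite -natrM mulnb.
by apply: ler_sum => i _; apply: ler_sum => j _; exact: richness_quotient.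
Qed.

Definition total_richness (w : walk (aff F)) : F := \sum_(v : w) richness (endpoint v).

(** The bound for quotients is applied to the endpoints of the walk itself; reversing the second
    path turns quotients into products. *)
Lemma total_richness_double w :
  total_richness w ^+ 2 <= n * total_richness (double_walk w).
Proof.
apply: le_trans (sum_richness_quotients _) _; rewrite ler_pM2l //.
rewrite /total_richness /= -(pair_big predT predT (fun u v : w => richness (endpoint u * endpoint v)%g)) /=.
apply: ler_sum => u _; rewrite [leRHS](reindex_inj (can_inj (@reverseK _ w))) /=.
by apply: ler_sum => v _; rewrite endpoint_reverse.
Qed.

Lemma total_richness_iter (w : walk (aff F)) (a : F) j : 0 <= a ->
  a * (n * #|w|%:R) <= total_richness w ->
  a ^+ (2 ^ j) * (n * #|iter j (@double_walk _) w|%:R) <= total_richness (iter j (@double_walk _) w).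
Proof.
move=> a0 h; elim: j => [|j IH]; first by rewrite expr1.
rewrite -(ler_pM2l n0); apply: le_trans (total_richness_double _).
rewrite /= card_prod natrM expnSr exprM -/(iter j _ w).
set b := a ^+ _ in IH *; set W := #|_|%:R in IH *.
have -> : n * (b ^+ 2 * (n * (W * W))) = (b * (n * W)) ^+ 2 by ring.
have bW0 : 0 <= b * (n * W) by rewrite !mulr_ge0 ?exprn_ge0 ?ler0n.
by rewrite lerXn2r ?nnegrE // (le_trans bW0).
Qed.

(** After Cauchy-Schwarz over the paths, count paths with pairs [x], [x'] of points of [A] sent into
    [A]. The diagonal gives the term [n]. Off it, the images of two points determine the affine map,
    so each of at most [n ^+ 4] quadruples accounts for at most [p * #|w|] paths. *)
Lemma total_richness_sqr_le (w : walk (aff F)) (p : F) : (0 < #|w|)%N ->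
  (forall g, hits F w g <= p * #|w|%:R) ->
  total_richness w ^+ 2 <= (n + n ^+ 4 * p) * #|w|%:R ^+ 2.
Proof.
move=> w0 hp; pose W : F := #|w|%:R.
have W0 : 0 < W by rewrite ltr0n.
have p0 : 0 <= p by rewrite -(pmulr_lge0 _ W0); apply: le_trans (hp 1%g); exact: hits_ge0.
apply: le_trans (cauchy_schwarz_sum _ _ _) _; rewrite count_predT size_index_enum expr2 mulrCA.
rewrite ler_pM2l //.
have -> : \sum_(v : w) richness (endpoint v) ^+ 2 = \sum_(x <- A) \sum_(x' <- A)
   \sum_(v : w) ((act (endpoint v) x \in A) && (act (endpoint v) x' \in A))%:R.
  transitivity (\sum_(v : w) \sum_(x <- A) \sum_(x' <- A)
    ((act (endpoint v) x \in A) && (act (endpoint v) x' \in A))%:R : F).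
    apply: eq_bigr => v _; rewrite expr2 mulr_suml; apply: eq_bigr => x _.
    by rewrite mulr_sumr; apply: eq_bigr => x' _; rewrite -natrM mulnb.
  by rewrite exchange_big; apply: eq_bigr => x _; rewrite exchange_big.
apply: le_trans (_ : \sum_(x <- A) \sum_(x' <- A) ((x == x')%:R * W + n ^+ 2 * (p * W)) <= _).
  apply: ler_sum => x _; apply: ler_sum => x' _.
  have [->|xx'] := eqVneq x x'.
    rewrite mul1r; apply: le_trans (_ : W <= _); last by rewrite lerDl !mulr_ge0 ?ler0n.
    by rewrite sum_natr_bool ler_nat max_card.
  rewrite mul0r add0r.
  have -> : \sum_(v : w) ((act (endpoint v) x \in A) && (act (endpoint v) x' \in A))%:R =
    \sum_(y <- A) \sum_(y' <- A) \sum_(v : w) ((act (endpoint v) x == y) && (act (endpoint v) x' == y'))%:R :> F.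
    rewrite exchange_big /= (eq_bigr (fun y' => \sum_(v : w) \sum_(y <- A)
      ((act (endpoint v) x == y) && (act (endpoint v) x' == y'))%:R)); last by move=> y' _; rewrite exchange_big.
    rewrite exchange_big /=; apply: eq_bigr => v _.
    rewrite -mulnb natrM -!(sum_eq_seq F) // mulr_sumr; apply: eq_bigr => y' _.
    by rewrite mulr_suml; apply: eq_bigr => y _; rewrite -natrM mulnb.
  have -> : n ^+ 2 * (p * W) = \sum_(y <- A) \sum_(y' <- A) p * W.
    by rewrite !big_const_seq !count_predT !iter_addr_0 -mulrnA -mulr_natl natrM expr2.
  apply: ler_sum => y _; apply: ler_sum => y' _.
  rewrite sum_natr_bool; set B := [set v | _].
  have [->|/set0Pn[v0]] := eqVneq B set0; first by rewrite cards0 mulr_ge0 ?ler0n.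
  rewrite inE => /andP[/eqP e0 /eqP e0'].
  apply: le_trans (hp (endpoint v0)); rewrite ler_nat subset_leq_card //.
  apply/subsetP => v; rewrite !inE => /andP[/eqP e /eqP e'].
  by apply/eqP/(aff_eq_2points xx'); rewrite ?e ?e'.
under eq_bigr do rewrite big_split /= -mulr_suml sum_eq_seq // big_const_seq count_predT iter_addr_0.
rewrite big_split /= [X in _ + X]big_const_seq count_predT iter_addr_0.
have -> : \sum_(x <- A) (x \in A)%:R * W = n * W.
  rewrite -mulr_suml; congr (_ * _); rewrite /n -(count_predT A) -sum1_count natr_sum.
  by rewrite big_seq [RHS]big_seq; apply: eq_bigr => x ->.
rewrite -[_ *+ size A *+ size A]mulr_natl -[_ *+ size A]mulr_natl -/n -/W le_eqVlt; apply/orP; left; apply/eqP; ring.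
Qed.

End Richness.
End RichMaps.

(** A map commuting with [s] preserves the fixed points of [s], and a slope other than 1 allows only
    one. *)
Lemma commute_fixed (F : fieldType) (s g : aff F) (x : F) : slope s != 1 ->
  act s x = x -> (s * g)%g = (g * s)%g -> act g x = x.
Proof.
move=> s1 sx sg; have h : act s (act g x) = act g x by rewrite -actM sg actM sx.
have s10 : slope s - 1 != 0 by rewrite subr_eq0.
move: h sx; set y := act g x; rewrite /act => hy hx.
apply/eqP; rewrite -subr_eq0 -(mulIr_eq0 _ (mulIf s10)) mulrBl !mulrBr !mulr1.
apply/eqP; transitivity ((slope s * y + shift s - y) - (slope s * x + shift s - x)); first by ring.
by rewrite hy hx !subrr.
Qed.

Lemma exists_fixed (F : fieldType) (s : aff F) : slope s != 1 -> exists x, act s x = x.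
Proof.
move=> s1; have s10 : 1 - slope s != 0 by rewrite subr_eq0 eq_sym.
by exists (shift s / (1 - slope s)); rewrite /act; field.
Qed.

(** * Rich affine maps in general position *)

Section Main.
Variables (F : realFieldType) (I : finType) (l : I -> aff F) (A : seq F).
Variables (alpha K : F) (t : nat).
Hypotheses (linj : injective (fun i => slope (l i)))
  (l2 : forall x y, (#|[set i | act (l i) x == y]| <= 2)%N)
  (uA : uniq A) (A0 : (0 < size A)%N) (I0 : (0 < #|I|)%N)
  (K1 : 1 <= K) (t0 : (0 < t)%N) (alpha01 : 0 <= alpha <= 1).
Let n : F := (size A)%:R.
Let N : F := #|I|%:R.
Hypotheses (rich : forall i, alpha * n <= richness A (l i))
  (hK : K^-1 ^+ t * n ^+ 4 + n <= alpha ^+ (2 ^ (t.*2 + 3)) * n ^+ 2)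
  (hN : 2 ^+ 32 * K ^+ 12 < N).

Let n0 : 0 < n. Proof. by rewrite ltr0n. Qed.
Let N0 : 0 < N. Proof. by rewrite ltr0n. Qed.
Let K0 : 0 < K. Proof. exact: lt_le_trans K1. Qed.
(** At least one doubling is included, so that the identity is the likeliest endpoint. *)
Let w i := iter i.+1 (@double_walk _) (base_walk l).

Let card_w i : (0 < #|w i|)%N.
Proof. by apply: card_iter_double; rewrite /= card_prod muln_gt0 I0. Qed.

Lemma hits_walk_le i g : hits F (w i) g <= return_prob F (w i) * #|w i|%:R.
Proof.
rewrite /return_prob divfK ?pnatr_eq0 -?lt0n ?card_w //.
exact: hits_double_le.
Qed.

(** Doubling preserves a power of [alpha] of the richness, whereas a small return probability would
    force the total richness down. [hK] is calibrated to the longest walk, [i = t.*2]. *)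
Lemma return_prob_ge i : (i <= t.*2)%N -> K^-1 ^+ t <= return_prob F (w i).
Proof.
move=> it; have /andP[a0 a1] := alpha01.
set p := return_prob F (w i).
have hbase : alpha ^+ 2 * (n * #|base_walk l|%:R) <= total_richness A (base_walk l).
  rewrite /total_richness -(pair_bigA _ (fun i j => richness A (l i / l j)%g)) /=.
  rewrite -(ler_pM2l n0); apply: le_trans (sum_richness_quotients uA A0 l).
  have -> : n * (alpha ^+ 2 * (n * #|{: I * I}|%:R)) = (N * (alpha * n)) ^+ 2.
    by rewrite card_prod natrM -/N; ring.
  have h0 : 0 <= N * (alpha * n) by rewrite !mulr_ge0 ?ler0n.
  have h : N * (alpha * n) <= \sum_i richness A (l i).
    by rewrite -sum_cst; apply: ler_sum => k _.
  by rewrite lerXn2r ?nnegrE // (le_trans h0).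
have := total_richness_iter uA A0 i.+1 (exprn_ge0 2 a0) hbase.
rewrite -exprM -expnS -/(w i) => h.
have W0 : 0 < #|w i|%:R :> F by rewrite ltr0n.
have := total_richness_sqr_le uA (card_w i) (hits_walk_le i).
rewrite -/n -/p => h'.
have h2 : (alpha ^+ (2 ^ i.+2) * (n * #|w i|%:R)) ^+ 2 <= (n + n ^+ 4 * p) * #|w i|%:R ^+ 2.
  apply: le_trans h'; rewrite lerXn2r ?nnegrE //.
    by rewrite !mulr_ge0 ?exprn_ge0 ?ler0n.
  by apply: le_trans h; rewrite !mulr_ge0 ?exprn_ge0 ?ler0n.
have h3 : alpha ^+ (2 ^ i.+3) * n ^+ 2 <= n + n ^+ 4 * p.
  rewrite -(ler_pM2r (exprn_gt0 2 W0)); apply: le_trans h2.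
  by rewrite [(2 ^ i.+3)%N]expnSr exprM le_eqVlt; apply/orP; left; apply/eqP; ring.
have h4 : alpha ^+ (2 ^ (t.*2 + 3)) <= alpha ^+ (2 ^ i.+3).
  have hit : (2 ^ i.+3 <= 2 ^ (t.*2 + 3))%N by apply: leq_pexp2l; rewrite ?addn3.
  exact: ler_wiXn2l hit.
have h5 : alpha ^+ (2 ^ (t.*2 + 3)) * n ^+ 2 <= alpha ^+ (2 ^ i.+3) * n ^+ 2.
  by rewrite ler_pM2r ?exprn_gt0.
have := le_trans hK (le_trans h5 h3); rewrite addrC lerD2l [leRHS]mulrC.
by rewrite ler_pM2r ?exprn_gt0.
Qed.

(** Words of length [growth_length j] in the approximate group [S] are counted twice: from below by
    growth from its slopes, from above by the Balog-Szemeredi-Gowers bound with [p] at least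
    [K^-1 ^+ t]. *)
Theorem rich_maps_bound j :
  (N / (2 ^+ 31 * K ^+ 12)) ^+ (2 ^ j) <=
  (2 ^+ 49 * K ^+ 20) ^+ (growth_length j).+1 * K ^+ t.
Proof.
have Kinv : 0 < K^-1 ^+ t by rewrite exprn_gt0 ?invr_gt0.
have [i it hi] : exists2 i, (i < t)%N & return_prob F (w i.*2) / K <= return_prob F (w i.+1.*2).
  have := @stationary_scale F _ (double_walk (base_walk l)) K t K0.
  rewrite -iterSr => /(_ (return_prob_ge (leqnn _)) t0)[i it].
  by rewrite -!iterSr; exists i.
have pge : K^-1 ^+ t <= return_prob F (w i.*2) by apply: return_prob_ge; rewrite leq_double ltnW.
set p := return_prob F (w i.*2) in hi pge *.
have p0 : 0 < p by apply: lt_le_trans pge.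
have en : p / K * #|w i.*2|%:R ^+ 2 <=
    #|w i.*2|%:R ^+ 2 * return_prob F (double_walk (double_walk (w i.*2))).
  by rewrite mulrC ler_pM2l ?exprn_gt0 ?ltr0n.
rewrite -energy_walk in en.
have [S [Sinv [a ha] Sw]] := approximate_group (card_w _) p0 (@hits_walk_le _) K1 en.
set W := w i.*2 in ha Sw en *.
set B := [set v | _] in ha.
have WF0 : 0 < #|W|%:R :> F by rewrite ltr0n card_w.
have c0 : 0 < 2 ^+ 31 * K ^+ 12 by rewrite mulr_gt0 ?exprn_gt0.
set c := 2 ^+ 31 * K ^+ 12 in ha c0 *.
have cN : 2 < N / c by rewrite ltr_pdivlMr // mulrA -exprS.
pose L := undup [seq slope s | s <- S].
(* A coset of [S] has mass at least [1 / c], while each slope carries mass at most [1 / N]. *)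
have LN : N / c <= (size L)%:R.
  have slopes s : #|[set v : W | slope (a^-1 * endpoint v)%g == s]|%:R <= N^-1 * #|W|%:R.
    have hs : slope_mass_le N^-1 W.
      rewrite /W /w; elim: (i.*2.+1) => [|k]; first exact: slope_mass_base.
      exact: slope_mass_double.
    apply: le_trans (hs (slope a * s)); rewrite ler_nat subset_leq_card //.
    apply/subsetP => v; rewrite !inE slopeM slopeV => /eqP <-.
    by rewrite mulrA mulfV ?mul1r ?slope_neq0.
  have := le_trans ha (card_le_image B slopes); set L' := undup _ => h.
  have L'L : (size L' <= size L)%N.
    apply: uniq_leq_size; rewrite ?undup_uniq // => s.
    by rewrite !mem_undup => /mapP[v]; rewrite mem_enum inE => vS ->; exact: map_f.
  have : #|W|%:R / c <= N^-1 * #|W|%:R * (size L)%:R.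
    by apply: le_trans h _; rewrite ler_wpM2l ?mulr_ge0 ?invr_ge0 ?ler0n ?ler_nat.
  by rewrite mulrAC mulrC ler_pM2r // -(ler_pM2l N0) mulrA mulfV ?gt_eqF // mul1r.
have L1 : (1 < size L)%N by rewrite -(ltr_nat F); lra.
have [s sS s1] : exists2 s, s \in S & slope s != 1.
  apply/hasP; apply: contraLR L1 => /hasPn hS; rewrite -leqNgt.
  apply: (@uniq_leq_size _ _ [:: 1]); rewrite ?undup_uniq // => x.
  by rewrite mem_undup => /mapP[g /hS + ->]; rewrite negbK inE.
(* If [s] commuted with all of [S], then [S] would fix the fixed point [x] of [s], and every path in
   [B] would send [x] to [act a x]. These paths have mass at most [2 / N], less than [1 / c]. *)
have [s' s'S ss'] : exists2 s', s' \in S & (s * s')%g != (s' * s)%g.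
  apply/hasP; apply: contraT => /hasPn hS; exfalso.
  have [x sx] := exists_fixed s1.
  have orb : orbit_mass_le (2 / N) W.
    rewrite /W /w; elim: (i.*2.+1) => [|k]; first exact: orbit_mass_base.
    exact: orbit_mass_double.
  have hB : #|B|%:R <= 2 / N * #|W|%:R.
    apply: le_trans (orb x (act a x)); rewrite ler_nat subset_leq_card //.
    apply/subsetP => v; rewrite !inE => vS.
    have /(_ (a^-1 * endpoint v)%g) := hS; rewrite vS negbK => /(_ isT)/eqP/(commute_fixed s1 sx).
    by rewrite actM => {2}<-; rewrite actVK.
  have := le_trans ha hB; rewrite mulrC ler_pM2r // -(ler_pM2l N0) mulrCA mulfV ?gt_eqF // mulr1.
  by move=> /(lt_le_trans cN); rewrite ltxx.
have [Z [uZ sZ wZ]] := word_growth Sinv j sS s'S ss' L1.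
have := Sw _ _ uZ wZ; rewrite sZ natrX -/L.
set M := (2 ^+ 49 * K ^+ 20) ^+ _; have M0 : 0 < M by rewrite exprn_gt0 // mulr_gt0 ?exprn_gt0.
move=> h.
have h1 : (N / c) ^+ (2 ^ j) <= (size L)%:R ^+ (2 ^ j).
  by rewrite lerXn2r ?nnegrE // ltW // (lt_trans _ cN).
have pM : 0 < p / M by rewrite divr_gt0.
have h2 : (N / c) ^+ (2 ^ j) <= M / p.
  apply: le_trans h1 _; rewrite -(ler_pM2r pM); apply: le_trans h _.
  by rewrite mulrA divfK ?gt_eqF // mulfV ?gt_eqF.
apply: le_trans h2 _; rewrite ler_pM2l //.
have : p^-1 <= (K^-1 ^+ t)^-1 by rewrite lef_pV2 ?posrE.
by rewrite exprVn invrK.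
Qed.

End Main.

(** * Choice of the parameters *)

Import boolp classical_sets numFieldNormedType.Exports.
Local Open Scope classical_set_scope.
Local Open Scope ring_scope.

Section Asymptotics.
Variable R : realType.

Lemma exists_nat_ge (x : R) : exists k : nat, (0 < k)%N /\ x <= k%:R.
Proof.
exists (Num.bound `|x|).+1; split => //.
apply: le_trans (_ : (Num.bound `|x|)%:R <= _); last by rewrite ler_nat.
by apply: le_trans (ler_norm x) _; rewrite ltW // archi_boundP.
Qed.

Lemma near_powR_ge (r c : R) : 0 < r -> \forall n \near \oo, c <= n%:R `^ r.
Proof.
move=> r0; have [k [k0 hk]] := exists_nat_ge (Num.max c 0 `^ r^-1).
exists k => // n /= kn.
have c0 : 0 <= Num.max c 0 by rewrite le_max lexx orbT.
apply: le_trans (_ : Num.max c 0 <= _); first by rewrite le_max lexx.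
have rn0 : r != 0 by rewrite gt_eqF.
have -> : Num.max c 0 = (Num.max c 0 `^ r^-1) `^ r by rewrite -powRrM mulVf // powRr1.
apply: ge0_ler_powR; rewrite ?nnegrE ?powR_ge0 ?(ltW r0) //.
by apply: le_trans hk _; rewrite ler_nat.
Qed.

(** The order of choice is [j], then [t], then [delta]. First [j] makes the growth exceed [n ^+ 5];
    then [t] makes the powers of [K] other than [K ^+ t = n ^+ 3] small; last, [delta] keeps the
    high power of [alpha] above [n^(-1/2)]. The [- 2] leaves room for discarding a vertical and a
    horizontal line. *)
Lemma rich_exponents (eps : R) : 0 < eps ->
  exists (delta : R) (t j : nat), [/\ 0 < delta < eps, (0 < t)%N &
  \forall n \near \oo, (0 < n)%N /\ forall N : R, n%:R `^ eps - 2 <= N ->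
    let K := n%:R `^ (3 / t%:R) in let alpha := n%:R `^ (- delta) in
    [/\ 1 <= K, 0 <= alpha <= 1,
        K^-1 ^+ t * n%:R ^+ 4 + n%:R <= alpha ^+ (2 ^ (t.*2 + 3)) * n%:R ^+ 2,
        2 ^+ 32 * K ^+ 12 < N &
        (2 ^+ 49 * K ^+ 20) ^+ (growth_length j).+1 * K ^+ t <
        (N / (2 ^+ 31 * K ^+ 12)) ^+ (2 ^ j)]].
Proof.
move=> e0.
have [j0 [_ hj0]] := exists_nat_ge (10 / eps).
have hj : 5 <= eps / 2 * (2 ^ j0)%:R.
  apply: le_trans (_ : eps / 2 * j0%:R <= _).
    by rewrite mulrAC ler_pdivlMr // -ler_pdivrMl // mulrC -[5 * 2]natrM.
  by rewrite ler_pM2l ?divr_gt0 // ler_nat ltnW // ltn_expl.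
set M := (growth_length j0).+1.
have [t1 [_ ht1]] := exists_nat_ge (144 / eps).
(* The first summand gives [K ^+ 12 <= n^(eps/4)], the second [K ^+ (20 * M) <= n^(1/2)]. *)
pose t := (t1 + 120 * M)%N.
have t0 : (0 < t)%N by rewrite /t /M addn_gt0 muln_gt0 orbT.
have tR : 0 < t%:R :> R by rewrite ltr0n.
have teps : 36 / t%:R <= eps / 4.
  rewrite ler_pdivrMr // mulrAC ler_pdivlMr // -ler_pdivrMl //.
  by apply: le_trans (_ : t1%:R <= _); [lra|rewrite ler_nat leq_addr].
have tM : 60 * M%:R / t%:R <= 2^-1 :> R.
  rewrite ler_pdivrMr // [leRHS]mulrC ler_pdivlMr // -!natrM ler_nat /t; lia.
pose E := (2 ^ (t.*2 + 3))%N.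
have E0 : 0 < E%:R :> R by rewrite ltr0n expn_gt0.
pose delta := Num.min (eps / 2) (2^-1 / E%:R).
have d0 : 0 < delta by rewrite lt_min !divr_gt0.
exists delta, t, j0; split => //.
  by rewrite d0 gt_min; apply/orP; left; lra.
(* The three thresholds serve, in order, for [2 * n <= n^(3/2)] in the condition on [alpha], for
   absorbing [2 ^+ 32] and the loss of 2 in [N], and for absorbing [(2 ^+ 49) ^+ M]. *)
have n1 : \forall n \near \oo, (2 : R) <= n%:R `^ 2^-1 by apply: near_powR_ge.
have n2 : \forall n \near \oo, (2 ^+ 33 : R) <= n%:R `^ (eps / 4) by apply: near_powR_ge; rewrite divr_gt0.
have n3 : \forall n \near \oo, ((2 ^+ 49) ^+ M + 1 : R) <= n%:R `^ 1 by apply: near_powR_ge.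
near=> n.
have h1 : (2 : R) <= n%:R `^ 2^-1 by near: n.
have h2 : (2 ^+ 33 : R) <= n%:R `^ (eps / 4) by near: n.
have h3 : ((2 ^+ 49) ^+ M + 1 : R) <= n%:R by rewrite -[leRHS]powRr1 //; near: n.
set y : R := n%:R in h1 h2 h3 *.
have C0 : 0 < (2 ^+ 49) ^+ M :> R by rewrite !exprn_gt0.
have y1 : 1 <= y by lra.
have y0 : 0 < y by lra.
have yn0 : y != 0 by rewrite gt_eqF.
have pD a b : y `^ (a + b) = y `^ a * y `^ b by rewrite powRD // yn0 implybT.
have pX a k : (y `^ a) ^+ k = y `^ (a * k%:R) by rewrite -powR_mulrn ?powR_ge0 // -powRrM.
have pN k : y ^+ k = y `^ k%:R by rewrite powR_mulrn // ltW.
have mono a b : a <= b -> y `^ a <= y `^ b by apply: ler_powR.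
split; first by rewrite -(ltr0n R).
move=> N hN; set K := y `^ (3 / t%:R); set alpha := y `^ (- delta).
have yE : 2 * 2 ^+ 32 * y `^ (3 * eps / 4) <= y `^ eps.
  have -> : y `^ eps = y `^ (eps / 4) * y `^ (3 * eps / 4) by rewrite -pD; congr (_ `^ _); field.
  by rewrite ler_pM2r ?powR_gt0 // -exprS.
have y3 : 1 <= y `^ (3 * eps / 4) by rewrite -[leLHS](powRr0 y); apply: mono; lra.
have NE : 2 ^+ 32 * y `^ (3 * eps / 4) + 1 <= N by lra.
have K12 : K ^+ 12 <= y `^ (eps / 4).
  by rewrite pX; apply: mono; apply: le_trans teps; rewrite mulrAC -natrM.
have Kt : K ^+ t = y ^+ 3 by rewrite pX divfK ?gt_eqF // pN.
have K0 : 0 < K by rewrite powR_gt0.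
split.
- by rewrite -[leLHS](powRr0 y); apply: mono; rewrite divr_ge0.
- by rewrite powR_ge0 /= -[leRHS](powRr0 y); apply: mono; rewrite oppr_le0 ltW.
- have -> : K^-1 ^+ t * y ^+ 4 = y by rewrite exprVn Kt -[y ^+ 4]/(y ^+ (3 + 1)) exprD mulKf ?expf_neq0 // expr1.
  apply: le_trans (_ : y `^ (- 2^-1) * y ^+ 2 <= _); last first.
    rewrite ler_pM2r ?exprn_gt0 // pX; apply: mono.
    rewrite mulNr lerN2 -/E -ler_pdivlMr // /delta ge_min; apply/orP; right; exact: lexx.
  rewrite pN -pD; have -> : - 2^-1 + 2%:R = 2^-1 + 1 :> R by field.
  rewrite pD powRr1 ?(ltW y0) //; have -> : y + y = 2 * y by ring.
  by rewrite ler_pM2r.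
- apply: lt_le_trans NE; apply: le_lt_trans (_ : 2 ^+ 32 * y `^ (3 * eps / 4) < _); last by rewrite ltrDl.
  rewrite ler_pM2l ?exprn_gt0 //; apply: le_trans K12 _; apply: mono; lra.
(* The left side is below [y * y * y ^+ 3]; on the right the base is at least [y^(eps/2)], and [hj]
   applies. *)
- apply: lt_le_trans (_ : y ^+ 5 <= _); last first.
    have c0 : 0 < 2 ^+ 31 * K ^+ 12 by rewrite mulr_gt0 ?exprn_gt0.
    apply: le_trans (_ : (y `^ (eps / 2)) ^+ (2 ^ j0) <= _).
      by rewrite pN pX; apply: mono.
    rewrite lerXn2r ?nnegrE ?powR_ge0 ?divr_ge0 ?(ltW c0) //.
      by apply: le_trans NE; rewrite addr_ge0 ?mulr_ge0 ?exprn_ge0 ?powR_ge0.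
    rewrite ler_pdivlMr //; apply: le_trans (_ : 2 ^+ 32 * y `^ (3 * eps / 4) <= _); last by lra.
    have -> : y `^ (3 * eps / 4) = y `^ (eps / 2) * y `^ (eps / 4) by rewrite -pD; congr (_ `^ _); field.
    rewrite [leRHS]mulrCA ler_pM2l ?powR_gt0 //.
    have h31 : 2 ^+ 31 <= 2 ^+ 32 :> R by rewrite ler_weXn2l // ler1n.
    by apply: ler_pM => //; rewrite exprn_ge0 // ltW.
  rewrite Kt exprMn -/M -[(K ^+ 20) ^+ M]exprM.
  have KM : K ^+ (20 * M) <= y `^ 2^-1.
    rewrite pX; apply: mono; apply: le_trans tM.
    by rewrite natrM le_eqVlt; apply/orP; left; apply/eqP; field; rewrite gt_eqF.
  have yh : y `^ 2^-1 <= y by rewrite -[leRHS]powRr1 ?(ltW y0) //; apply: mono; lra.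
  have -> : y ^+ 5 = y * y * y ^+ 3 by ring.
  rewrite ltr_pM2r ?exprn_gt0 //.
  apply: lt_le_trans (_ : y * K ^+ (20 * M) <= _).
    by rewrite ltr_pM2r ?exprn_gt0 //; lra.
  by rewrite ler_pM2l // (le_trans KM).
Unshelve. all: by end_near. Qed.

End Asymptotics.

(** * From lines to affine maps *)

Section Lines.
Variable R : realType.

Lemma card_le_injection (U : pointedType) (m : nat) (X : set U) :
  (`I_m #<= X)%card -> exists f : nat -> U,
    {in `I_m &, injective f} /\ forall i, (i < m)%N -> X (f i).
Proof. by move=> /pcard_leP[f]; exists f; split; [exact: inj|exact: funS]. Qed.

Lemma card_eq_seq (A : set R) (n : nat) : (A #= `I_n)%card ->
  exists s : seq R, [/\ uniq s, size s = n & forall x, x \in s <-> A x].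
Proof.
rewrite card_eq_sym => h; have [f [fA finj fsurj]] := elimT card_set_bijP h.
exists [seq f i | i <- iota 0 n]; split.
- rewrite map_inj_in_uniq ?iota_uniq // => i j.
  by rewrite !mem_iota /= => iI jI; apply: finj; rewrite inE.
- by rewrite size_map size_iota.
- move=> x; split => [/mapP[i + ->]|/fsurj[i iI <-]].
    by rewrite mem_iota /= => iI; exact: fA.
  by apply: map_f; rewrite mem_iota.
Qed.

Definition graph (g : aff R) : set (R * R) := [set p | p.2 = act g p.1].

(** With second coefficient -1 the normal vector depends on the slope alone, as [parallel]
    requires. *)
Lemma graph_line g : graph g = line (slope g) (-1) (- shift g).
Proof.
apply/seteqP; split => -[x y]; rewrite /graph /line /act /= => h; first by rewrite h; ring.
by apply/eqP; rewrite -subr_eq0 -oppr_eq0; apply/eqP; rewrite -(subrr (- shift g)) -{1}h; ring.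
Qed.

Lemma graph_parallel g h : slope g = slope h -> parallel (graph g) (graph h).
Proof.
move=> gh; exists (slope g), (-1), (- shift g), (- shift h); split.
- by move=> [s0 _]; have := slope_neq0 g; rewrite -/(slope g) s0 eqxx.
- exact: graph_line.
- by rewrite gh graph_line.
Qed.

Lemma line_scale (k a b c : R) : k != 0 -> line (k * a) (k * b) (k * c) = line a b c.
Proof.
move=> k0; apply/seteqP; split => -[x y]; rewrite /line /= -!mulrA -mulrDr; last by move=> ->.
exact: mulfI.
Qed.

Lemma line_cases (L : set (R * R)) : is_line L ->
  [\/ exists g, L = graph g, exists c, L = line 1 0 c | exists c, L = line 0 1 c].
Proof.
move=> [a [b [c [ab ->]]]].
have [b0|b0] := eqVneq b 0.
  have a0 : a != 0 by apply/eqP => a0; apply: ab; rewrite a0 b0.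
  apply: Or32; exists (a^-1 * c); rewrite -(line_scale 1 0 (a^-1 * c) a0).
  by rewrite mulr1 mulr0 mulVKf // b0.
have [a0|a0] := eqVneq a 0.
  apply: Or33; exists (b^-1 * c); rewrite -(line_scale 0 1 (b^-1 * c) b0).
  by rewrite mulr1 mulr0 mulVKf // a0.
have s0 : - (a / b) != 0 by rewrite oppr_eq0 mulf_neq0 ?invr_eq0.
apply: Or31; exists (@Aff R (- (a / b), c / b) s0).
rewrite graph_line /slope /shift /=.
have nb0 : - b != 0 by rewrite oppr_eq0.
rewrite -(line_scale (- (a / b)) (-1) (- (c / b)) nb0); congr line; by field.
Qed.

(** A point of a graph is determined by its first coordinate, so projecting the given points to that
    coordinate is injective. *)
Lemma richness_ge (s : seq R) (g : aff R) (r : R) : 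
  card_at_least r (graph g `&` ([set x | x \in s] `*` [set x | x \in s])) -> r <= richness s g.
Proof.
move=> [k rk /card_le_injection[e [einj eX]]]; apply: le_trans rk _.
pose X := [seq (e i).1 | i <- iota 0 k].
have -> : richness s g = (size [seq x <- s | act g x \in s])%:R.
  rewrite size_filter -sum1_count natr_sum big_mkcond /=.
  by apply: eq_bigr => x _; case: (_ \in _).
have -> : k = size X by rewrite size_map size_iota.
rewrite ler_nat; apply: uniq_leq_size.
  rewrite map_inj_in_uniq ?iota_uniq // => i j; rewrite !mem_iota /= => ik jk ij.
  apply: einj; rewrite ?inE //.
  have [hi _] := eX i ik; have [hj _] := eX j jk.
  by rewrite (surjective_pairing (e i)) (surjective_pairing (e j)) hi hj ij.
move=> x /mapP[i]; rewrite mem_iota /= => ik ->.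
have [hi [h1 h2]] := eX i ik; rewrite mem_filter -hi; apply/andP; split; [exact: h2|exact: h1].
Qed.

End Lines.

Theorem theorem1 (R : realType) (eps : R) (heps : 0 < eps) :
  exists delta : R, 0 < delta < eps /\
    \forall n \near \oo,
      forall A : set R, (A #= `I_n)%card ->
      forall LL : set (set (R * R)),
        (forall L, LL L -> is_line L) ->
        card_at_least (n%:R `^ eps) LL ->
        (forall L, LL L ->
           card_at_least (n%:R `^ (1 - delta)) (L `&` (A `*` A))) ->
        (exists L1 L2, [/\ LL L1, LL L2, L1 <> L2 & parallel L1 L2]) \/
        (exists L1 L2 L3,
           [/\ LL L1, LL L2 & LL L3] /\
           [/\ L1 <> L2, L1 <> L3 & L2 <> L3] /\
           exists p : R * R, [/\ L1 p, L2 p & L3 p]).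
Proof.
have [delta [t [j [hd t0 ev]]]] := rich_exponents heps.
exists delta; split => //; apply: filterS ev => n [n0 hN] A hA LL LLline [m hm /card_le_injection[h [hinj hLL]]] LLrich.
have [s [us sn sA]] := card_eq_seq hA; subst n.
have AE : A = [set x | x \in s] by apply/seteqP; split => x /sA.
apply: contrapT => /not_orP[nopar noconc].
have par L1 L2 : LL L1 -> LL L2 -> parallel L1 L2 -> L1 = L2.
  by move=> h1 h2 p; apply: contrapT => h12; apply: nopar; exists L1, L2.
(* [LL] may be infinite; only [m] of its lines are kept, where [m] is at least [n^eps]. *)
pose H (i : 'I_m) := h i.
have HLL i : LL (H i) by exact: hLL.
have Hinj : injective H.
  by move=> i i' /hinj e; apply: val_inj; apply: e; rewrite inE /=; exact: ltn_ord.
pose good (i : 'I_m) : bool := `[< exists g, H i = graph g >].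
pose I : finType := {i : 'I_m | good i}.
have /choice[l lE] : forall i : I, exists g, H (val i) = graph g.
  by move=> [i gi]; exact: (asboolP _ gi).
(* Two vertical lines are parallel, and so are two horizontal ones; hence at most one of each kind
   is lost. *)
have cardI : (m <= #|I| + 2)%N.
  have -> : #|I| = #|[pred i | good i]| by rewrite card_sig.
  rewrite -[leqLHS]card_ord -(cardC [pred i | good i]) leq_add2l.
  pose vert i : bool := `[< exists c, H i = line 1 0 c >].
  pose hor i : bool := `[< exists c, H i = line 0 1 c >].
  have vertP i : reflect (exists c, H i = line 1 0 c) (vert i) by exact: asboolP.
  have horP i : reflect (exists c, H i = line 0 1 c) (hor i) by exact: asboolP.
  apply: leq_trans (_ : #|[set i | vert i]%SET :|: [set i | hor i]%SET| <= _)%N.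
    apply: subset_leq_card; apply/fintype.subsetP => i; rewrite !inE /= => /asboolPn ng.
    case: (line_cases (LLline _ (HLL i))) => hi; first by case: ng.
      by apply/orP; left; apply/vertP.
    by apply/orP; right; apply/horP.
  have n10 : (1, 0) <> (0, 0) :> R * R by move=> [/eqP]; rewrite oner_eq0.
  have n01 : (0, 1) <> (0, 0) :> R * R by move=> [/eqP]; rewrite oner_eq0.
  apply: leq_trans (leq_card_setU _ _) _; rewrite -[2%N]/(1 + 1)%N; apply: leq_add.
    apply/card_le1_eqP => i i'; rewrite !inE => -[c hc] [c' hc'].
    apply: Hinj; apply: par => //; exists 1, 0, c', c; by split.
  apply/card_le1_eqP => i i'; rewrite !inE => -[c hc] [c' hc'].
  apply: Hinj; apply: par => //; exists 0, 1, c', c; by split.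
have hN' : (size s)%:R `^ eps - 2 <= #|I|%:R.
  rewrite lerBlDr; apply: le_trans hm _.
  by rewrite -natrD ler_nat.
have [K1 a01 hK hN2 hbound] := hN _ hN'.
have I0 : (0 < #|I|)%N.
  rewrite -(ltr_nat R); apply: lt_trans hN2; rewrite mulr_gt0 ?exprn_gt0 //.
  exact: lt_le_trans K1.
have linj : injective (fun i => slope (l i)).
  move=> i i' e; apply: val_inj; apply: Hinj; rewrite !lE.
  by apply: par; [rewrite -lE|rewrite -lE|exact: graph_parallel].
(* Three maps sending [x] to [y] would give three distinct lines through [(x, y)]. *)
have l2 x y : (#|[set i | act (l i) x == y]%SET| <= 2)%N.
  rewrite leqNgt; apply/negP => /card_gt2P[i1 [i2 [i3 [[]]]]].
  rewrite !inE => /eqP e1 /eqP e2 /eqP e3 [i12 i23 i31]; apply: noconc.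
  have ne i i' : i != i' -> H (val i) <> H (val i').
    by move=> /eqP ii' /Hinj/val_inj.
  exists (H (val i1)), (H (val i2)), (H (val i3)); do 2?split => //.
  - by split; apply: ne; rewrite // eq_sym.
  - by exists (x, y); rewrite !lE /graph /=.
have rich i : (size s)%:R `^ (- delta) * (size s)%:R <= richness s (l i).
  have y0 : (size s)%:R != 0 :> R by rewrite pnatr_eq0 -lt0n.
  have -> : (size s)%:R `^ (- delta) * (size s)%:R = (size s)%:R `^ (1 - delta).
    by rewrite powRD ?y0 ?implybT // powRr1 // mulrC.
  by apply: richness_ge; rewrite -lE -AE; apply: LLrich.
have := rich_maps_bound linj l2 us n0 I0 K1 t0 a01 rich hK hN2 j.
by rewrite leNgt hbound.
Qed.
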